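(* Let $\mathfrak{g}$ be the Lie algebra of a connected Lie group and let $\gamma$ be a vector field on $\mathfrak{g}$. A multiplier matrix for $\gamma$ determines a cohomology class in $H^1(\mathfrak{g})$ and one in $H^2(\mathfrak{g})$. The vector field $\gamma$ is derivable from a Lagrangian if and only if the corresponding cohomology classes vanish.
   Context: All objects are smooth; summation convention is used. Fix a basis $\{E_i\}$ of $\mathfrak{g}$ with structure constants $C_{ij}^k$, $\{E_i,E_j\}=C_{ij}^kE_k$ (the Lie algebra bracket is written $\{\cdot,\cdot\}$), and let $(w^i)$ be the corresponding linear coordinates on $\mathfrak{g}$. Write $\gamma=\gamma^i\,\partial/\partial w^i$. Multiplier matrix for $\gamma$: a matrix $(k_{ij})$ of functions on $\mathfrak{g}$ satisfying the reduced Helmholtz conditions (1) $\det(k_{ij})\ne0$ and $k_{ij}=k_{ji}$; (2) $\gamma^k\frac{\partial k_{ij}}{\partial w^k}-k_{kj}\lambda^k_i-k_{ik}\lambda^k_j=0$; (3) $k_{ij}\phi^i_k=k_{ik}\phi^i_j$; (4) $\frac{\partial k_{ij}}{\partial w^l}=\frac{\partial k_{lj}}{\partial w^i}$; where $$\lambda^k_i=-\tfrac12\Big(\frac{\partial\gamma^k}{\partial w^i}-w^jC^k_{ji}\Big),$$ $$\phi^l_j=\tfrac12\gamma^i\frac{\partial^2\gamma^l}{\partial w^i\partial w^j}+\tfrac12\gamma^iC^l_{ij}-\tfrac14\frac{\partial\gamma^i}{\partial w^j}\frac{\partial\gamma^l}{\partial w^i}-\tfrac34C^k_{ij}w^i\frac{\partial\gamma^l}{\partial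 w^k}+\tfrac14w^iC^l_{ik}\frac{\partial\gamma^k}{\partial w^j}-\tfrac14w^mw^nC^k_{mj}C^l_{nk}.$$ Derivable from a Lagrangian: there is a smooth function $l$ on $\mathfrak{g}$ with non-singular Hessian $\big(\frac{\partial^2l}{\partial w^i\partial w^j}\big)$ such that $\gamma$ is the vector field determined by the Euler-Poincaré equations of $l$, $\gamma\big(\frac{\partial l}{\partial w^i}\big)=C^j_{ki}w^k\frac{\partial l}{\partial w^j}$ for all $i$. Cohomology: $H^\ast(\mathfrak{g})$ is the Lie algebra cohomology of $\mathfrak g$ with values in $\mathbf{R}$. A linear map $\nu=(\nu_i):\mathfrak{g}\to\mathbf{R}$ is a 1-cocycle if $\nu_kC^k_{ij}=0$ (1-coboundaries are zero). An alternating bilinear map $\mu=(\mu_{ij})$ is a 2-cocycle if $\mu_{il}C^l_{jk}+\mu_{jl}C^l_{ki}+\mu_{kl}C^l_{ij}=0$, and a 2-coboundary if $\mu_{ij}=\theta_kC^k_{ij}$ for some constants $\theta_k$. The corresponding classes: given a multiplier matrix $(k_{ij})$, there is a function $l$ on $\mathfrak{g}$ with $\frac{\partial^2l}{\partial w^i\partial w^j}=k_{ij}$, determined up to the addition of a term linear in the $w^k$ and a constant. There are constants $\mu_{ij}=-\mu_{ji}$ and $\nu_i$ such that $$\gamma\Big(\frac{\partial l}{\partial w^i}\Big)-C^j_{ki}w^k\frac{\partial l}{\partial w^j}=\mu_{ji}w^j+\nu_i .$$ The cohomology classes are those of the cocycles $\nu=(\nu_i)$ and $\mu=(\mu_{ij})$;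 replacing $l$ by $l+\theta_kw^k$ leaves $\nu$ unchanged and replaces $\mu_{ij}$ by $\mu_{ij}-\theta_kC^k_{ij}$. *)

(* Defs.v *)
From HB Require Import structures.
From mathcomp Require Import all_boot all_order all_algebra.
From mathcomp Require Import all_classical all_reals all_analysis.
Import Order.TTheory GRing.Theory Num.Theory.
Import numFieldNormedType.Exports.

Set Implicit Arguments.
Unset Strict Implicit.
Unset Printing Implicit Defensive.

Local Open Scope classical_set_scope.
Local Open Scope ring_scope.

Definition lie_bracket (R : realType) (g : vectType R) (br : g -> g -> g) : Prop :=
  [/\ forall (a : R) x y z, br (a *: x + y) z = a *: br x z + br y z,
      forall (a : R) x y z, br z (a *: x + y) = a *: br z x + br z y,
      forall x, br x x = 0
    & forall x y z, br x (br y z) + br y (br z x) + br z (br x y) = 0].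

(* Once a basis [E_i] of an n-dimensional Lie algebra g is fixed, a function on
   g is represented by its expression ['rV[R]_n -> R] in the linear coordinates
   w^0, ..., w^(n-1) of that basis (w^i is [w 0 i]), and a vector field
   gamma = gamma^i d/dw^i by [gamma : 'rV[R]_n -> 'rV[R]_n], with gamma^i at w
   being [gamma w 0 i].  Indices run from 0 to n-1. *)
Section Functions.
Variables (R : realType) (n : nat).
Implicit Types (f l : 'rV[R]_n -> R) (gamma : 'rV[R]_n -> 'rV[R]_n).
Implicit Types (k : 'rV[R]_n -> 'M[R]_n) (w : 'rV[R]_n) (i j : 'I_n).

Definition pd i f : 'rV[R]_n -> R := fun w => 'D_(delta_mx 0 i) f w.

Fixpoint class_C (r : nat) f : Prop :=
  continuous f /\
  if r is r'.+1 then
    forall i, (forall w, derivable f w (delta_mx 0 i)) /\ class_C r' (pd i f)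
  else True.

Definition smooth f : Prop := forall r, class_C r f.

Definition smooth_vf gamma : Prop := forall i, smooth (fun w => gamma w 0 i).

Definition smooth_mx k : Prop := forall i j, smooth (fun w => k w i j).

Definition hessian l w : 'M[R]_n := \matrix_(i, j) pd i (pd j l) w.

(* gamma acting on f as a derivation *)
Definition vf_act gamma f w : R := \sum_i gamma w 0 i * pd i f w.

End Functions.

(* [C i j k] is the structure constant C_ij^k: {E_i, E_j} = C_ij^k E_k. *)
Section StructureConstants.
Variables (R : realType) (n : nat) (C : 'I_n -> 'I_n -> 'I_n -> R).
Implicit Types (l : 'rV[R]_n -> R) (gamma : 'rV[R]_n -> 'rV[R]_n).
Implicit Types (k : 'rV[R]_n -> 'M[R]_n) (w : 'rV[R]_n) (i j : 'I_n).

(* lambda^b_i *)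
Definition lambda gamma (b i : 'I_n) w : R :=
  - (2^-1 * (pd i (fun x => gamma x 0 b) w - \sum_j w 0 j * C j i b)).

(* phi^a_j *)
Definition phi gamma (a j : 'I_n) w : R :=
    2^-1 * \sum_i gamma w 0 i * pd i (pd j (fun x => gamma x 0 a)) w
  + 2^-1 * \sum_i gamma w 0 i * C i j a
  - 4^-1 * \sum_i pd j (fun x => gamma x 0 i) w * pd i (fun x => gamma x 0 a) w
  - 3 / 4 * \sum_i \sum_b C i j b * w 0 i * pd b (fun x => gamma x 0 a) w
  + 4^-1 * \sum_i \sum_b w 0 i * C i b a * pd j (fun x => gamma x 0 b) w
  - 4^-1 * \sum_p \sum_q \sum_b w 0 p * w 0 q * C p j b * C q b a.

(* The reduced Helmholtz conditions. *)
Definition multiplier gamma k : Prop :=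
  smooth_mx k /\
  [/\ forall w, \det (k w) != 0 /\ (forall i j, k w i j = k w j i),
      forall w i j, vf_act gamma (fun x => k x i j) w
        - \sum_b k w b j * lambda gamma b i w
        - \sum_b k w i b * lambda gamma b j w = 0,
      forall w j b, \sum_i k w i j * phi gamma i b w
                  = \sum_i k w i b * phi gamma i j w
    & forall w i j m, pd m (fun x => k x i j) w = pd i (fun x => k x m j) w].

Definition EP_defect gamma l i w : R :=
  vf_act gamma (pd i l) w - \sum_j \sum_b C b i j * w 0 b * pd j l w.

Definition EP_lagrangian gamma l : Prop :=
  [/\ smooth l,
      forall w, \det (hessian l w) != 0
    & forall i w, EP_defect gamma l i w = 0].

Definition derivable_from_lagrangian gamma : Prop :=
  exists l, EP_lagrangian gamma l.

Definition cocycle1 (nu : 'rV[R]_n) : Prop :=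
  forall i j, \sum_b nu 0 b * C i j b = 0.

Definition cocycle2 (mu : 'M[R]_n) : Prop :=
  (forall i j, mu i j = - mu j i) /\
  forall i j b,
    \sum_a (mu i a * C j b a + mu j a * C b i a + mu b a * C i j a) = 0.

Definition coboundary2 (mu : 'M[R]_n) : Prop :=
  exists theta : 'rV[R]_n, forall i j, mu i j = \sum_b theta 0 b * C i j b.

(* 1-coboundaries vanish, so a class in H^1 is a 1-cocycle. *)
Definition H1 : set 'rV[R]_n := [set nu | cocycle1 nu].

Definition class2 (mu : 'M[R]_n) : set 'M[R]_n :=
  [set mu' | coboundary2 (mu' - mu)].

(* H^2 is the set of cosets, modulo 2-coboundaries, of 2-cocycles; its zero
   element is [class2 0]. *)
Definition H2 : set (set 'M[R]_n) := [set class2 mu | mu in cocycle2].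

(* [c] is the pair of classes of the constants (nu, mu) obtained from some
   function l with Hessian k.  That these constants are cocycles and that the
   pair depends on neither l nor the constants is not part of the definition. *)
Definition multiplier_classes gamma k (c : 'rV[R]_n * set 'M[R]_n) : Prop :=
  exists (l : 'rV[R]_n -> R) (mu : 'M[R]_n) (nu : 'rV[R]_n),
  [/\ smooth l, forall w, hessian l w = k w,
      forall i j, mu i j = - mu j i,
      forall i w, EP_defect gamma l i w = \sum_j mu j i * w 0 j + nu 0 i
    & c = (nu, class2 mu)].

End StructureConstants.

(* Main.v *)
Require Import Defs.
From HB Require Import structures.
From mathcomp Require Import all_boot all_order all_algebra.
From mathcomp Require Import all_classical all_reals all_analysis.
From mathcomp Require Import ring lra.
Import Order.TTheory GRing.Theory Num.Theory.
Import numFieldNormedType.Exports.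
Local Open Scope classical_set_scope.
Local Open Scope ring_scope.

Set Implicit Arguments.
Unset Strict Implicit.
Unset Printing Implicit Defensive.

(** Write A, W, L for the matrices of derivatives of gamma, of [{w, -}] and of
    the form [(x, y) |-> dl({x, y})], put B = A + W, and let K be the Hessian of
    l.  The second Helmholtz condition says that the derivative of the
    Euler-Poincare defect of l is [(B K - K B^T) / 2 - L]; being antisymmetric,
    it is a constant mu, and the defect is [w mu + nu].  Differentiating
    [mu + L = (B K - K B^T) / 2] along gamma and using the Jacobi identity gives
    [Phi K - K Phi^T = L(w mu + nu) - W mu - mu W^T], where L(p) is the form
    [p({-, -})].  The left-hand side vanishes by the third condition; the
    right-hand side is affine in w, its constant term is the coboundary of nu
    and its linear term that of mu.  For mu = 0 and nu = 0 the same two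
    identities show that the Hessian of a Lagrangian is a multiplier. *)

(** * Restriction to lines and the mean value theorem *)

Section DirectionalDerivatives.
Variables (R : realType) (V : normedModType R).
Implicit Types (f : V -> R) (w v : V).

Lemma line_quotient f w v (t : R) :
  (fun h : R => h^-1 *: (((fun s : R => f (w + s *: v)) \o shift t) (h *: 1)
                  - f (w + t *: v))) =
  (fun h : R => h^-1 *: ((f \o shift (w + t *: v)) (h *: v) - f (w + t *: v))).
Proof.
apply/funext => h /=; congr (_ *: (f _ - _)).
by rewrite scalerDl [h *: 1]mulr1 addrCA.
Qed.

Lemma is_derive_line f w v (t : R) : derivable f (w + t *: v) v ->
  is_derive t 1 (fun s : R => f (w + s *: v)) ('D_v f (w + t *: v)).
Proof.
move=> df; split; first by rewrite /derivable line_quotient.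
by rewrite /derive line_quotient.
Qed.

(** The step [h] is absorbed into the direction and the one-variable theorem is applied on [[0, 1]].
    The sign of [h] then never matters, and [t] is the fraction of the segment travelled. *)
Lemma MVT_line f w v (h : R) : (forall x, derivable f x v) ->
  exists2 t : R, 0 <= t <= 1 &
    f (w + h *: v) - f w = h * 'D_v f (w + (t * h) *: v).
Proof.
move=> df.
have d1 (t : R) : is_derive t 1 (fun s : R => f (w + s *: (h *: v)))
    (h * 'D_v f (w + (t * h) *: v)).
  have := @is_derive_line f w v (t * h) (df _).
  move=> d2; have -> : (fun s : R => f (w + s *: (h *: v))) =
     (fun s : R => f (w + s *: v)) \o (fun s => s * h).
    by apply/funext => s /=; rewrite scalerA.
  rewrite mulrC; apply: (@is_derive1_comp _ (fun s : R => f (w + s *: v))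
    (fun s => s * h)).
  have -> : (fun s : R => s * h) = h \*: (@id R).
    by apply/funext => s; rewrite /= [RHS]mulrC.
  by apply: is_derive_eq; rewrite [LHS]mulr1.
have [t /andP[t0 t1]] := @MVT_segment R _ _ 0 1 ler01 (fun t _ => d1 t)
  (@derivable_within_continuous _ _ _ _
    (fun t _ => @ex_derive _ _ _ _ _ _ _ (d1 t))).
rewrite subr0 mulr1 scale1r scale0r addr0 => E.
by exists t => //; apply/andP; split; [move: t0|move: t1]; rewrite bnd_simp.
Qed.

Lemma derivable_cst_dir f w v : (forall x, derivable f x v) ->
  (forall x, 'D_v f x = 0) -> forall h : R, f (w + h *: v) = f w.
Proof.
move=> df d0 h; have [t _] := MVT_line w h df.
by rewrite d0 mulr0 => /eqP; rewrite subr_eq0 => /eqP.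
Qed.

End DirectionalDerivatives.

(** * From coordinate derivatives to continuity and arbitrary directional derivatives *)

Section CoordinateDerivatives.
Variables (R : realType) (n : nat).
Implicit Types (f : 'rV[R]_n -> R) (w v : 'rV[R]_n).

(** One radius serves a whole finite family, and closeness is measured coordinate by coordinate,
    which is how the mean value points are controlled later. *)
Lemma continuous_box m (F : 'I_m -> 'rV[R]_n -> R) w (e : R) :
  (forall i, continuous (F i)) -> 0 < e ->
  exists2 d : R, 0 < d & forall i v, (forall j, `|v 0 j - w 0 j| < d) ->
    `|F i v - F i w| <= e.
Proof.
move=> cF e0.
have cFw i : \forall v \near w, `|F i v - F i w| <= e.
  by have /cvgrPdistC_le /(_ _ e0) := cF i w.
have /(@nbhs_ballP R 'rV[R]_n w)[d /= d0 bd] :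
  nbhs w [set v | forall i, `|F i v - F i w| <= e]
    by exact: (@filter_forall _ _ _ (nbhs w) _ cFw).
exists d => // i v hv.
suff /bd : ball w d v by apply.
by split=> // a j; rewrite (ord1 a) /ball /= distrC; exact: hv.
Qed.

(** Travel from [w] to [w + h] parallel to the axes, one coordinate at a time. The mean value
    theorem on each leg gives a partial derivative at a point of the box, where it is within [e] of
    its value at [w]. *)
Lemma C1_expansion f w (e : R) :
  (forall i x, derivable f x (delta_mx 0 i)) ->
  (forall i, continuous (pd i f)) -> 0 < e ->
  exists2 d : R, 0 < d & forall h : 'rV[R]_n, (forall j, `|h 0 j| < d) ->
    `|f (w + h) - f w - \sum_i h 0 i * pd i f w| <= e * \sum_i `|h 0 i|.
Proof.
move=> df cf e0; have [d d0 hd] := continuous_box w cf e0.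
exists d => // h hh.
(* [P k] keeps the first [k] coordinates of [h]: these are the corners of the path, from [P 0 = 0]
   to [P n = h]. *)
pose P k : 'rV[R]_n := \row_j (if (j < k)%N then h 0 j else 0).
have P0 : P 0 = 0 by apply/rowP => j; rewrite !mxE ltn0.
have Pn : P n = h by apply/rowP => j; rewrite !mxE ltn_ord.
have PS (k : 'I_n) : P k.+1 = P k + h 0 k *: delta_mx 0 k.
  apply/rowP => j; rewrite !mxE ltnS leq_eqVlt eqxx /=.
  have [->|jk] := eqVneq j k; first by rewrite eqxx ltnn /= add0r mulr1.
  by rewrite -(inj_eq val_inj) in jk; rewrite (negbTE jk) /= mulr0 addr0.
have -> : f (w + h) - f w = \sum_(k < n) (f (w + P k.+1) - f (w + P k)).
  rewrite -(big_mkord xpredT (fun k => f (w + P k.+1) - f (w + P k))).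
  by rewrite telescope_sumr // Pn P0 addr0.
rewrite -sumrB mulr_sumr; apply: le_trans (ler_norm_sum _ _ _) _.
apply: ler_sum => k _; rewrite PS addrA.
have [t /andP[t0 t1] ->] := MVT_line (w + P k) (h 0 k) (df k).
rewrite -mulrBr normrM mulrC ler_wpM2r //; apply: hd => j.
rewrite !mxE eqxx /= (_ : forall a b c : R, a + b + c - a = b + c); last first.
  by move=> a b c; ring.
have [->|jk] := eqVneq j k.
  rewrite ltnn add0r mulr1 normrM; apply: le_lt_trans (hh k).
  by rewrite ger0_norm // ler_piMl.
by rewrite mulr0 addr0; case: ifP => // _; rewrite normr0.
Qed.

(** [class_C] speaks only of coordinate directions; the first-order expansion at [h *: v], divided
    by [h], yields every other direction. *)
Lemma C1_is_derive f w v :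
  (forall i x, derivable f x (delta_mx 0 i)) ->
  (forall i, continuous (pd i f)) ->
  is_derive w v f (\sum_i v 0 i * pd i f w).
Proof.
move=> df cf.
suff H : h^-1 *: ((f \o shift w) (h *: v) - f w) @[h --> 0^'] -->
   (\sum_i v 0 i * pd i f w : R).
  split; [exact: (cvgP _ H) | exact: cvg_lim H].
apply/cvgrPdist_le => e e0.
(* [S] dominates each coordinate of [v], so [|h| * S < d] keeps [h *: v] in the box; it also
   dominates the sum of the [|v 0 i|], so the tolerance [e / S] leaves an error of at most [e]. The
   summand 1 keeps it positive. *)
pose S := 1 + \sum_i `|v 0 i|.
have S0 : 0 < S by rewrite ltr_pwDl // sumr_ge0.
have [d d0 hd] := C1_expansion w df cf (divr_gt0 e0 S0).
near=> h.
have h0 : h != 0 by near: h; exact: nbhs_dnbhs_neq.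
have hS : `|h| * S < d.
  rewrite -ltr_pdivlMr //; near: h.
  by apply: dnbhs0_lt; exact: divr_gt0.
have hv j : `|(h *: v) 0 j| < d.
  rewrite mxE normrM; apply: le_lt_trans hS; rewrite ler_wpM2l //.
  by rewrite /S (bigD1 j) //= addrCA lerDl addr_ge0 ?sumr_ge0.
have := hd _ hv.
rewrite /= [h *: v + w]addrC.
have -> : \sum_i (h *: v) 0 i * pd i f w = h * \sum_i v 0 i * pd i f w.
  by rewrite mulr_sumr; apply: eq_bigr => i _; rewrite mxE mulrA.
have -> : \sum_i `|(h *: v) 0 i| = `|h| * \sum_i `|v 0 i|.
  by rewrite mulr_sumr; apply: eq_bigr => i _; rewrite mxE normrM.
move=> E; rewrite distrC -(ler_pM2l (x := `|h|)) ?normr_gt0 // -normrM mulrBr.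
rewrite [_ *: _]/(_ * _) mulrA divff // mul1r.
apply: le_trans E _; rewrite mulrCA ler_wpM2l //.
rewrite -mulrA ler_piMr ?(ltW e0) // ler_pdivrMl // mulr1.
by rewrite /S lerDr.
Unshelve. all: by end_near. Qed.

(** The Poincaré primitive is known at first only through its partial derivatives; the expansion
    with tolerance 1 makes such a function locally Lipschitz at each point, hence continuous. *)
Lemma C1_continuous f :
  (forall i x, derivable f x (delta_mx 0 i)) ->
  (forall i, continuous (pd i f)) -> continuous f.
Proof.
move=> df cf w; apply/(@cvgrPdist_le R _ _ (nbhs w) _) => e e0.
have [d d0 hd] := C1_expansion w df cf ltr01.
pose M := 1 + \sum_i (1 + `|pd i f w|).
have M0 : 0 < M by rewrite ltr_pwDl // sumr_ge0 // => i _; rewrite addr_ge0.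
have eM : 0 < e / M by exact: divr_gt0.
apply/(@nbhs_ballP R 'rV[R]_n w).
exists (Num.min d (e / M)); first by rewrite /= lt_min d0.
move=> x xb; rewrite /= distrC.
have hx j : `|(x - w) 0 j| < Num.min d (e / M).
  by have := xb.2 0 j; rewrite /ball /= distrC !mxE.
have hxd j : `|(x - w) 0 j| < d.
  by apply: lt_le_trans (hx j) _; rewrite ge_min lexx.
have := hd (x - w) hxd.
rewrite addrCA subrr addr0 mul1r => E.
have : `|f x - f w| <= \sum_i `|(x - w) 0 i| * (1 + `|pd i f w|).
  rewrite -[f x - f w](subrK (\sum_i (x - w) 0 i * pd i f w)).
  apply: le_trans (ler_normD _ _) _.
  under [leRHS]eq_bigr do rewrite mulrDr mulr1.
  rewrite big_split /= lerD //; apply: le_trans (ler_norm_sum _ _ _) _.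
  by apply: ler_sum => i _; rewrite normrM.
move=> /le_trans; apply.
apply: le_trans (_ : e / M * \sum_i (1 + `|pd i f w|) <= e).
  rewrite mulr_sumr; apply: ler_sum => i _; rewrite ler_wpM2r ?addr_ge0 //.
  by apply: ltW; apply: lt_le_trans (hx i) _; rewrite ge_min lexx orbT.
by rewrite -mulrA ler_piMr ?(ltW e0) // ler_pdivrMl // mulr1 lerDr.
Qed.

End CoordinateDerivatives.

(** * Symmetry of second derivatives *)

Section MixedPartials.
Variables (R : realType) (n : nat).
Implicit Types (f : 'rV[R]_n -> R) (w : 'rV[R]_n) (i j : 'I_n).

Lemma is_derive_translate (V : normedModType R) (f : V -> R) (c x v : V) :
  derivable f (x + c) v ->
  is_derive x v (fun y => f (y + c)) ('D_v f (x + c)).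
Proof.
have E : (fun h : R => h^-1 *: (((fun y => f (y + c)) \o shift x) (h *: v)
           - f (x + c)))
       = (fun h : R => h^-1 *: ((f \o shift (x + c)) (h *: v) - f (x + c))).
  by apply/funext => h /=; rewrite addrA.
by move=> df; split; rewrite /derivable /derive E.
Qed.

(** The mean value theorem is used twice: in direction [i] for the increment of [f] in direction
    [j], then in direction [j] for [pd i f]. *)
Lemma second_difference f i j w (h : R) :
  (forall x, derivable f x (delta_mx 0 i)) ->
  (forall x, derivable (pd i f) x (delta_mx 0 j)) ->
  exists s t : R, [/\ 0 <= s <= 1, 0 <= t <= 1 &
    f (w + h *: delta_mx 0 i + h *: delta_mx 0 j) - f (w + h *: delta_mx 0 i)
      - (f (w + h *: delta_mx 0 j) - f w) =
    h * (h * pd j (pd i f)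
      (w + (s * h) *: delta_mx 0 i + (t * h) *: delta_mx 0 j))].
Proof.
move=> di dji.
pose g x := f (x + h *: delta_mx 0 j) - f x.
have dg x : is_derive x (delta_mx 0 i) g
    (pd i f (x + h *: delta_mx 0 j) - pd i f x).
  by apply: is_deriveB;
    [exact: is_derive_translate | exact/derivableP].
have [s s01 gE] := MVT_line w h (fun x => @ex_derive _ _ _ _ _ _ _ (dg x)).
have [t t01 E] := MVT_line (w + (s * h) *: delta_mx 0 i) h dji.
exists s, t; split=> //; move: gE.
by rewrite (@derive_val _ _ _ _ _ _ _ (dg _)) E.
Qed.

(** The second difference is symmetric in [i] and [j], so the two mixed derivatives take a common
    value at two points close to [w]. By continuity they differ at [w] by at most any [e > 0]. *)
Lemma pd_comm f i j w :
  (forall k x, derivable f x (delta_mx 0 k)) ->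
  (forall k l x, derivable (pd k f) x (delta_mx 0 l)) ->
  (forall k l, continuous (pd l (pd k f))) ->
  pd i (pd j f) w = pd j (pd i f) w.
Proof.
move=> d1 d2 c2; apply/eqP; rewrite -subr_eq0 -normr_eq0.
rewrite eq_le normr_ge0 andbT; apply/ler_addgt0Pr => e e0; rewrite add0r.
have e20 : 0 < e / 2 by lra.
pose F (b : 'I_2) := if b == 0 then pd i (pd j f) else pd j (pd i f).
have cF b : continuous (F b) by rewrite /F; case: ifP.
have [d d0 hd] := continuous_box w cF e20.
(* If [i = j] both displacements fall on the same coordinate, so [2 * h < d] is what keeps the
   points in the box. *)
pose h := d / 3.
have h0 : h != 0 by rewrite /h; apply/eqP; lra.
have inbox (s t : R) k l m : 0 <= s <= 1 -> 0 <= t <= 1 ->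
    `|(w + (s * h) *: delta_mx 0 k + (t * h) *: delta_mx 0 l) 0 m - w 0 m| < d.
  move=> /andP[s0 s1] /andP[t0 t1]; rewrite !mxE /=.
  have [sh0 sh1] : 0 <= s * h /\ s * h <= h by rewrite /h; split; nra.
  have [th0 th1] : 0 <= t * h /\ t * h <= h by rewrite /h; split; nra.
  have hh : h + h < d by rewrite /h; lra.
  by case: (m == k); case: (m == l); rewrite /= ?mulr1 ?mulr0 ?addr0;
    rewrite ger0_norm; lra.
have [s [t [s01 t01 E1]]] := second_difference w h (d1 i) (fun x => d2 i j x).
have [s' [t' [s'01 t'01 E2]]] := second_difference w h (d1 j) (fun x => d2 j i x).
have E : pd j (pd i f) (w + (s * h) *: delta_mx 0 i + (t * h) *: delta_mx 0 j)
  = pd i (pd j f) (w + (s' * h) *: delta_mx 0 j + (t' * h) *: delta_mx 0 i).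
  have cancel a b c u p q : a - b - (c - u) = h * (h * p) ->
      a - c - (b - u) = h * (h * q) -> p = q.
    move=> ep eq; apply: (mulfI h0); apply: (mulfI h0); rewrite -ep -eq; ring.
  rewrite [w + h *: delta_mx 0 j + _]addrAC in E2; exact: cancel E1 E2.
have H1 := hd 0 _ (fun m => inbox s' t' j i m s'01 t'01).
have H2 := hd 1 _ (fun m => inbox s t i j m s01 t01).
rewrite /F /= in H1 H2; rewrite E in H2.
apply: le_trans (ler_distD _ _ _) _; rewrite [e]splitr; apply: lerD H2.
by rewrite distrC; exact: H1.
Qed.

End MixedPartials.

(** * Calculus of smooth functions *)

Section SmoothFunctions.
Variables (R : realType) (n : nat).
Implicit Types (f g : 'rV[R]_n -> R) (w : 'rV[R]_n) (i j : 'I_n).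

Lemma smooth_continuous f : smooth f -> continuous f.
Proof. by move=> /(_ 0%N) []. Qed.

Lemma smooth_derivable f i w : smooth f -> derivable f w (delta_mx 0 i).
Proof. by move=> /(_ 1%N) [_ /(_ i) []]. Qed.

Lemma smooth_pd f i : smooth f -> smooth (pd i f).
Proof. by move=> sf r; have [_ /(_ i) []] := sf r.+1. Qed.

Lemma smoothP f : continuous f -> (forall i w, derivable f w (delta_mx 0 i)) ->
  (forall i, smooth (pd i f)) -> smooth f.
Proof.
move=> cf df sf [//|r]; split=> // i.
by split=> [w|]; [exact: df|exact: sf].
Qed.

Lemma smooth_pd_comm f i j w : smooth f -> pd i (pd j f) w = pd j (pd i f) w.
Proof.
move=> sf; apply: pd_comm.
- by move=> k x; exact: smooth_derivable.
- by move=> k l x; apply: smooth_derivable; exact: smooth_pd.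
- by move=> k l; apply: smooth_continuous; do 2 apply: smooth_pd.
Qed.

Lemma pd_cst (a : R) i w : pd i (fun=> a) w = 0.
Proof. exact: derive_cst. Qed.

Lemma pdD f g i w : smooth f -> smooth g ->
  pd i (fun x => f x + g x) w = pd i f w + pd i g w.
Proof. by move=> sf sg; apply: deriveD; exact: smooth_derivable. Qed.

Lemma pdB f g i w : smooth f -> smooth g ->
  pd i (fun x => f x - g x) w = pd i f w - pd i g w.
Proof. by move=> sf sg; apply: deriveB; exact: smooth_derivable. Qed.

Lemma pdM f g i w : smooth f -> smooth g ->
  pd i (fun x => f x * g x) w = pd i f w * g w + f w * pd i g w.
Proof.
move=> sf sg; have /= := @deriveM _ _ f g w (delta_mx 0 i).
rewrite /pd => ->; try exact: smooth_derivable.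
by rewrite addrC [_ *: _]mulrC.
Qed.

Lemma pd_sum m (F : 'I_m -> 'rV[R]_n -> R) i w : (forall k, smooth (F k)) ->
  pd i (fun x => \sum_k F k x) w = \sum_k pd i (F k) w.
Proof.
move=> sF; rewrite -(@derive_sum _ _ _ m F w (delta_mx 0 i)).
  by congr ('D_ _ _ w); apply/funext => x; rewrite fct_sumE.
by move=> k; exact: smooth_derivable.
Qed.

Lemma smooth_cst (a : R) : smooth (fun _ : 'rV[R]_n => a).
Proof.
move=> r.
have ca (b : R) : continuous (fun _ : 'rV[R]_n => b) by exact: cst_continuous.
elim: r a => [|r IH] a; first by split.
split=> [|i]; first exact: ca.
split=> [w|]; first exact: derivable_cst.
by rewrite (_ : pd i _ = fun=> 0) //; apply/funext => w; exact: pd_cst.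
Qed.

Lemma smoothD f g : smooth f -> smooth g -> smooth (fun x => f x + g x).
Proof.
move=> sf sg r; elim: r f g sf sg => [|r IH] f g sf sg.
  by split=> // x; apply: continuousD; exact: smooth_continuous.
split=> [x|i]; first by apply: continuousD; exact: smooth_continuous.
split=> [w|]; first by apply: derivableD; exact: smooth_derivable.
rewrite (_ : pd i _ = fun x => pd i f x + pd i g x); last first.
  by apply/funext => w; exact: pdD.
by apply: IH; exact: smooth_pd.
Qed.

Lemma smoothM f g : smooth f -> smooth g -> smooth (fun x => f x * g x).
Proof.
move=> sf sg r; elim: r f g sf sg => [|r IH] f g sf sg.
  by split=> // x; apply: continuousM; exact: smooth_continuous.
split=> [x|i]; first by apply: continuousM; exact: smooth_continuous.
split=> [w|]; first by apply: derivableM; exact: smooth_derivable.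
rewrite (_ : pd i _ = fun x => pd i f x * g x + f x * pd i g x); last first.
  by apply/funext => w; exact: pdM.
(* The induction hypothesis gives the two products of the Leibniz rule at order [r] only, so
   [smoothD] does not apply; closure under sums is proved at a fixed order. *)
have C_add (f1 f2 : 'rV[R]_n -> R) q : class_C q f1 -> class_C q f2 ->
    class_C q (fun x => f1 x + f2 x).
  elim: q f1 f2 => [|q IHq] f1 f2 [c1 d1] [c2 d2].
    by split=> // x; apply: continuousD; [exact: c1|exact: c2].
  split=> [x|k]; first by apply: continuousD; [exact: c1|exact: c2].
  have [[e1 C1] [e2 C2]] := (d1 k, d2 k).
  split=> [w|]; first by apply: derivableD; [exact: e1|exact: e2].
  rewrite (_ : pd k _ = fun x => pd k f1 x + pd k f2 x); first exact: IHq.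
  by apply/funext => w; apply: deriveD; [exact: e1|exact: e2].
by apply: C_add; apply: IH => //; exact: smooth_pd.
Qed.

Lemma smoothN f : smooth f -> smooth (fun x => - f x).
Proof.
move=> sf; rewrite (_ : (fun x => _) = fun x => -1 * f x).
  by apply: smoothM => //; exact: smooth_cst.
by apply/funext => x; rewrite mulN1r.
Qed.

Lemma smoothB f g : smooth f -> smooth g -> smooth (fun x => f x - g x).
Proof. by move=> sf sg; apply: smoothD => //; exact: smoothN. Qed.

Lemma smooth_sum m (F : 'I_m -> 'rV[R]_n -> R) :
  (forall k, smooth (F k)) -> smooth (fun x => \sum_k F k x).
Proof.
elim: m F => [|m IH] F sF.
  rewrite (_ : (fun x => _) = fun=> 0); first exact: smooth_cst.
  by apply/funext => x; rewrite big_ord0.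
rewrite (_ : (fun x => _) =
  fun x => \sum_(k < m) F (widen_ord (leqnSn m) k) x + F ord_max x).
  by apply: smoothD => //; exact: IH.
by apply/funext => x; rewrite big_ord_recr.
Qed.

Lemma is_derive_coord (w v : 'rV[R]_n) j :
  is_derive w v (fun x : 'rV[R]_n => x 0 j) (v 0 j).
Proof.
have H : h^-1 *: (((fun x : 'rV[R]_n => x 0 j) \o shift w) (h *: v) - w 0 j)
    @[h --> (0 : R)^'] --> v 0 j.
  apply: cvg_near_cst; near=> h.
  rewrite /= !mxE addrK [LHS]mulrA mulVf ?mul1r //.
  by near: h; exact: nbhs_dnbhs_neq.
by split; [exact: (cvgP _ H)|exact: cvg_lim H].
Unshelve. all: by end_near. Qed.

Lemma pd_coord i j w : pd i (fun x => x 0 j) w = (i == j)%:R.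
Proof.
rewrite /pd (@derive_val _ _ _ _ _ _ _ (is_derive_coord w _ j)) !mxE eqxx.
by rewrite eq_sym.
Qed.

Lemma smooth_coord j : smooth (fun x : 'rV[R]_n => x 0 j).
Proof.
apply: smoothP => [|i w|i]; first exact: coord_continuous.
  exact: (@ex_derive _ _ _ _ _ _ _ (is_derive_coord w _ j)).
rewrite (_ : pd i _ = fun=> (i == j)%:R); first exact: smooth_cst.
by apply/funext => w; exact: pd_coord.
Qed.

Lemma smooth_is_derive f w v : smooth f ->
  is_derive w v f (\sum_i v 0 i * pd i f w).
Proof.
move=> sf; apply: C1_is_derive => [i x|i]; first exact: smooth_derivable.
by apply: smooth_continuous; exact: smooth_pd.
Qed.

(** The derivative in direction [w] is a combination of the vanishing partials, so [f] is constant
    on the line from 0 through [w]. *)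
Lemma pd0_cst f : smooth f -> (forall i w, pd i f w = 0) ->
  forall w, f w = f 0.
Proof.
move=> sf f0 w.
have fw x := @smooth_is_derive f x w sf.
have dw x : derivable f x w := @ex_derive _ _ _ _ _ _ _ (fw x).
have Dw0 x : 'D_w f x = 0.
  rewrite (@derive_val _ _ _ _ _ _ _ (fw x)) big1 // => i _.
  by rewrite f0 mulr0.
by have := derivable_cst_dir 0 dw Dw0 1; rewrite scale1r add0r.
Qed.

End SmoothFunctions.

(** * The Poincaré lemma for 1-forms, by integration along rays *)

Section PoincareLemma.
Variables (R : realType) (n : nat).
Implicit Types (f : 'rV[R]_n -> R) (w u v : 'rV[R]_n).

Lemma box_bounded f (c : R) : continuous f ->
  exists2 M : R, 0 < M &
    forall q : 'rV[R]_n, (forall j, `|q 0 j| <= c) -> `|f q| <= M.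
Proof.
move=> cf.
have /compact_bounded := continuous_compact (continuous_subspaceT cf)
  (rV_compact (fun _ : 'I_n => @segment_compact R (- c) c)).
move=> /pinfty_ex_gt0[M M0 hM]; exists M => // q hq; apply: hM.
by exists q => // j /=; rewrite in_itv /= -ler_norml; exact: hq.
Qed.

Lemma is_derive_smooth_line f u v (t : R) : smooth f ->
  is_derive t 1 (fun s : R => f (u + s *: v))
    (\sum_i v 0 i * pd i f (u + t *: v)).
Proof.
move=> sf; have fv := smooth_is_derive (u + t *: v) v sf.
have := is_derive_line (@ex_derive _ _ _ _ _ _ _ fv).
by rewrite (@derive_val _ _ _ _ _ _ _ fv).
Qed.

Lemma is_derive_continuous (h dh : R -> R) :
  (forall t : R, is_derive t 1 h (dh t)) -> continuous h.
Proof.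
move=> hd t; apply: differentiable_continuous; apply/derivable1_diffP.
exact: (@ex_derive _ _ _ _ _ _ _ (hd t)).
Qed.

Lemma continuous_ray f u : smooth f -> continuous (fun t : R => f (t *: u)).
Proof.
move=> sf; apply: (@is_derive_continuous _
  (fun t => \sum_i u 0 i * pd i f (0 + t *: u))) => t.
have := @is_derive_smooth_line f 0 u t sf.
by under eq_fun do rewrite add0r.
Qed.

(** The integrand of the homotopy formula for the 1-form with components [G i]: the form at [t *: w]
    evaluated on the radial vector [w]. *)
Definition radial (G : 'I_n -> 'rV[R]_n -> R) (t : R) w : R :=
  \sum_i w 0 i * G i (t *: w).

Definition radial_primitive (G : 'I_n -> 'rV[R]_n -> R) w : R :=
  \int[lebesgue_measure]_(t in `[0, 1]) radial G t w.

Variable G : 'I_n -> 'rV[R]_n -> R.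
Hypothesis smoothG : forall i, smooth (G i).
Hypothesis closedG : forall i j w, pd i (G j) w = pd j (G i) w.

(** This is the derivative of the integrand in direction [j] once closedness has exchanged the
    indices; in this form it is also the derivative of [t * G j (t *: w)] in [t]. *)
Definition radial_pd (j : 'I_n) (t : R) w : R :=
  G j (t *: w) + t * \sum_i w 0 i * pd i (G j) (t *: w).

Lemma is_derive_radial j w (t x : R) :
  is_derive x 1 (fun y => radial G t (w + y *: delta_mx 0 j))
    (radial_pd j t (w + x *: delta_mx 0 j)).
Proof.
pose u y := w + y *: delta_mx 0 j : 'rV[R]_n.
have du i : is_derive x 1 (fun y : R => u y 0 i) (j == i)%:R.
  have := @is_derive_smooth_line _ w (delta_mx 0 j) x (@smooth_coord R n i).
  under eq_bigr do rewrite pd_coord.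
  rewrite (bigD1 i) //= big1 ?addr0 => [|k /negbTE->]; last by rewrite mulr0.
  by rewrite !mxE !eqxx mulr1 eq_sym.
have dG i : is_derive x 1 (fun y : R => G i (t *: u y))
    (t * pd j (G i) (t *: u x)).
  have E y : t *: u y = t *: w + y *: (t *: delta_mx 0 j).
    by rewrite /u scalerDr !scalerA mulrC.
  have := @is_derive_smooth_line _ (t *: w) (t *: delta_mx 0 j) x (smoothG i).
  under eq_fun do rewrite -E.
  rewrite -E (bigD1 j) //= big1 ?addr0 => [|k /negbTE jk].
    by rewrite !mxE !eqxx mulr1.
  by rewrite !mxE jk mulr0 mul0r.
have -> : (fun y => radial G t (w + y *: delta_mx 0 j)) =
    \sum_i (fun y : R => u y 0 i * G i (t *: u y)).
  by apply/funext => y; rewrite fct_sumE.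
have -> : radial_pd j t (u x) =
    \sum_i (u x 0 i * (t * pd j (G i) (t *: u x)) + G i (t *: u x) * (j == i)%:R).
  rewrite big_split /= addrC; congr (_ + _).
    rewrite (bigD1 j) //= big1 ?addr0 ?eqxx ?mulr1 // => i.
    by rewrite eq_sym => /negbTE->; rewrite mulr0.
  by rewrite mulr_sumr; apply: eq_bigr => i _; rewrite closedG mulrCA.
apply: is_derive_sum => i; exact: is_deriveM.
Qed.

Lemma continuous_radial w : continuous (fun t => radial G t w).
Proof.
rewrite (_ : (fun t => _) = \sum_i (fun t => w 0 i * G i (t *: w))).
  move=> t; elim/big_ind : _ => [|f g|i _].
  - exact: cst_continuous.
  - exact: continuousD.
  - apply: continuousM; first exact: cst_continuous.
    exact: continuous_ray.
by apply/funext => t; rewrite fct_sumE.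
Qed.

Lemma continuous_radial_pd j w : continuous (fun t => radial_pd j t w).
Proof.
rewrite (_ : (fun t => _) =
  (fun t => G j (t *: w)) + (fun t => t * (\sum_i w 0 i * pd i (G j) (t *: w)))).
  move=> t; apply: continuousD; first exact: continuous_ray.
  apply: continuousM; first exact: cvg_id.
  rewrite (_ : (fun t => _) = \sum_i (fun t => w 0 i * pd i (G j) (t *: w))).
    elim/big_ind : _ => [|f g|i _].
    - exact: cst_continuous.
    - exact: continuousD.
    - apply: continuousM; first exact: cst_continuous.
      by apply: continuous_ray; exact: smooth_pd.
  by apply/funext => s; rewrite fct_sumE.
by [].
Qed.

(** A bound uniform in both [x] and [t] supplies the constant dominating function for
    differentiation under the integral sign. *)
Lemma radial_pd_bounded j w : exists2 M : R, 0 < M &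
  forall x t : R, `|x| <= 1 -> 0 <= t <= 1 ->
    `|radial_pd j t (w + x *: delta_mx 0 j)| <= M.
Proof.
(* The box of half-width [c] contains [w + x *: delta_mx 0 j] for [|x| <= 1], together with its
   multiples by [t] in [[0, 1]]. *)
pose c := 1 + \sum_i `|w 0 i|.
have c0 : 0 <= c by rewrite addr_ge0 // sumr_ge0.
have [M M0 hM] := box_bounded c (smooth_continuous (smoothG j)).
have : forall i, exists B, forall q : 'rV[R]_n, (forall m, `|q 0 m| <= c) ->
    `|pd i (G j) q| <= B.
  move=> i.
  have [B _ hB] := box_bounded c (smooth_continuous (smooth_pd i (smoothG j))).
  by exists B.
move=> /choice[B hB].
exists (M + \sum_i c * `|B i|).
  by rewrite ltr_pwDl // sumr_ge0 // => i _; rewrite mulr_ge0.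
move=> x t x1 /andP[t0 t1]; rewrite /radial_pd.
set u := w + _.
have uc m : `|u 0 m| <= c.
  rewrite /u !mxE /= [c]addrC; apply: le_trans (ler_normD _ _) _.
  rewrite lerD //; first by rewrite (bigD1 m) //= lerDl sumr_ge0.
  by rewrite normrM; case: eqP => _; rewrite ?normr1 ?mulr1 ?normr0 ?mulr0.
have tuc m : `|(t *: u) 0 m| <= c.
  by rewrite mxE normrM ger0_norm //; apply: le_trans (uc m); rewrite ler_piMl.
apply: le_trans (ler_normD _ _) _; apply: lerD; first exact: hM.
rewrite normrM (ger0_norm t0); apply: le_trans (_ : 1 * _ <= _).
  by apply: ler_wpM2r.
rewrite mul1r; apply: le_trans (ler_norm_sum _ _ _) _.
apply: ler_sum => i _; rewrite normrM ler_pM //.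
by apply: le_trans (hB i _ tuc) _; exact: ler_norm.
Qed.

(** By the fundamental theorem of calculus: the antiderivative [t * G j (t *: w)] is 0 at [t = 0]
    and [G j w] at [t = 1]. *)
Lemma integral_radial_pd j w :
  (\int[lebesgue_measure]_(t in `[0, 1]) radial_pd j t w)%R = G j w.
Proof.
have dF (t : R) : is_derive t 1 (fun t : R => t * G j (t *: w)) (radial_pd j t w).
  have dG : is_derive t 1 (fun t : R => G j (t *: w))
      (\sum_i w 0 i * pd i (G j) (t *: w)).
    have := @is_derive_smooth_line _ 0 w t (smoothG j).
    by under eq_fun do rewrite add0r; rewrite add0r.
  apply: is_derive_eq (is_deriveM (is_derive_id t 1) dG) _.
  by rewrite [_ *: 1]mulr1 addrC.
have cF := is_derive_continuous dF.
rewrite /Rintegral (@continuous_FTC2 R _ (fun t : R => t * G j (t *: w))) //.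
- by rewrite scale1r mul1r mul0r sube0.
- by apply: continuous_subspaceT; exact: continuous_radial_pd.
- split=> [t _||]; first exact: (@ex_derive _ _ _ _ _ _ _ (dF t)).
  + by apply: cvg_at_right_filter; exact: cF.
  + by apply: cvg_at_left_filter; exact: cF.
- by move=> t _; rewrite derive1E (@derive_val _ _ _ _ _ _ _ (dF t)).
Qed.

(** Differentiate under the integral sign in the displacement [x] along coordinate [j], at [x = 0]
    inside []-1, 1[]; the resulting integral is [integral_radial_pd]. *)
Lemma is_derive_radial_primitive j w :
  is_derive w (delta_mx 0 j) (radial_primitive G) (G j w).
Proof.
pose phi (x t : R) := radial G t (w + x *: delta_mx 0 j).
have [M M0 hM] := radial_pd_bounded j w.
have dphi (x t : R) : is_derive x 1 (phi ^~ t) (radial_pd j t (w + x *: delta_mx 0 j)).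
  exact: is_derive_radial.
have dphiE (x t : R) : partial1of2 phi x t = radial_pd j t (w + x *: delta_mx 0 j).
  by rewrite partial1of2E (@derive_val _ _ _ _ _ _ _ (dphi x t)).
have HM x t : `]-1, 1[%classic x -> `[0, 1]%classic t ->
    `|partial1of2 phi x t| <= cst M t.
  rewrite dphiE /= !in_itv /= => /andP[x0 x1] t01; apply: hM => //.
  by rewrite ler_norml !ltW.
have itv0 : `]-1, 1[%classic (0 : R) by rewrite /= in_itv /= ltrN10 ltr01.
have intphi (f : R -> R) : continuous f ->
    lebesgue_measure.-integrable `[0, 1] (EFin \o f).
  move=> cf; apply: continuous_compact_integrable; first exact: segment_compact.
  exact: continuous_subspaceT.
have H := @cvg_differentiation_under_integral R _ _ lebesgue_measure phi `[0, 1]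
  (measurable_itv _) 0 _ _ itv0 (fun x _ => intphi _ (@continuous_radial _))
  (fun x t _ _ => @ex_derive _ _ _ _ _ _ _ (dphi x t)) (cst M) (fun=> ltW M0)
  (intphi _ (@cst_continuous _ _ M)) HM.
have {}H : h^-1 *: ((radial_primitive G \o shift w) (h *: delta_mx 0 j)
    - radial_primitive G w) @[h --> (0 : R)^'] --> G j w.
  rewrite -integral_radial_pd.
  have -> : \int[lebesgue_measure]_(t in `[0, 1]) radial_pd j t w
    = \int[lebesgue_measure]_(t in `[0, 1]) partial1of2 phi 0 t.
    by apply: eq_Rintegral => t _; rewrite dphiE scale0r addr0.
  apply: cvg_trans H; apply: near_eq_cvg; near=> h.
  rewrite /radial_primitive /phi /= addr0 [h *: _ + w]addrC; congr (_ *: (_ - _)).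
  by apply: eq_Rintegral => t _; rewrite scale0r addr0.
by split; [exact: (cvgP _ H)|exact: cvg_lim H].
Unshelve. all: by end_near. Qed.

Lemma poincare_lemma : exists2 f : 'rV[R]_n -> R, smooth f &
  forall i w, pd i f w = G i w.
Proof.
have dF i w := is_derive_radial_primitive i w.
have pdF i : pd i (radial_primitive G) = G i.
  by apply/funext => w; rewrite /pd (@derive_val _ _ _ _ _ _ _ (dF i w)).
have derF i w : derivable (radial_primitive G) w (delta_mx 0 i).
  exact: (@ex_derive _ _ _ _ _ _ _ (dF i w)).
exists (radial_primitive G); last by move=> i w; rewrite pdF.
apply: smoothP => // [|i]; last by rewrite pdF.
apply: C1_continuous => // i; rewrite pdF; exact: smooth_continuous.
Qed.

End PoincareLemma.

(** * Derivation of matrix-valued functions along gamma, and the underlying matrix identity *)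

Section VectorFieldAction.
Variables (R : realType) (n : nat) (gamma : 'rV[R]_n -> 'rV[R]_n).
Implicit Types (f g : 'rV[R]_n -> R) (F G : 'rV[R]_n -> 'M[R]_n).

Lemma vf_act_cst (a : R) w : vf_act gamma (fun=> a) w = 0.
Proof. by rewrite /vf_act big1 // => i _; rewrite pd_cst mulr0. Qed.

Lemma vf_actD f g w : smooth f -> smooth g ->
  vf_act gamma (fun x => f x + g x) w = vf_act gamma f w + vf_act gamma g w.
Proof.
move=> sf sg; rewrite /vf_act -big_split; apply: eq_bigr => i _ /=.
by rewrite pdD // mulrDr.
Qed.

Lemma vf_actM f g w : smooth f -> smooth g ->
  vf_act gamma (fun x => f x * g x) w =
  vf_act gamma f w * g w + f w * vf_act gamma g w.
Proof.
move=> sf sg; rewrite /vf_act mulr_suml mulr_sumr -big_split.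
by apply: eq_bigr => i _ /=; rewrite pdM // mulrDr mulrA mulrCA.
Qed.

Lemma vf_act_sum m (H : 'I_m -> 'rV[R]_n -> R) w : (forall k, smooth (H k)) ->
  vf_act gamma (fun x => \sum_k H k x) w = \sum_k vf_act gamma (H k) w.
Proof.
move=> sH; rewrite /vf_act exchange_big; apply: eq_bigr => i _ /=.
by rewrite pd_sum // mulr_sumr.
Qed.

Lemma smooth_vf_act f : smooth_vf gamma -> smooth f -> smooth (vf_act gamma f).
Proof.
move=> sg sf; apply: smooth_sum => i; apply: smoothM => //.
exact: smooth_pd.
Qed.

Definition mx_act F w : 'M[R]_n := \matrix_(i, j) vf_act gamma (fun x => F x i j) w.

Lemma mx_actD F G w : smooth_mx F -> smooth_mx G ->
  mx_act (fun x => F x + G x) w = mx_act F w + mx_act G w.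
Proof.
move=> sF sG; apply/matrixP => i j; rewrite !mxE -vf_actD //.
by congr vf_act; apply/funext => x; rewrite mxE.
Qed.

Lemma mx_act_tr F w : mx_act (fun x => (F x)^T) w = (mx_act F w)^T.
Proof.
apply/matrixP => i j; rewrite !mxE.
by congr vf_act; apply/funext => x; rewrite mxE.
Qed.

Lemma mx_act_cst (M : 'M[R]_n) w : mx_act (fun=> M) w = 0.
Proof. by apply/matrixP => i j; rewrite !mxE vf_act_cst. Qed.

Lemma mx_actZ (a : R) F w : smooth_mx F ->
  mx_act (fun x => a *: F x) w = a *: mx_act F w.
Proof.
move=> sF; apply/matrixP => i j; rewrite !mxE.
rewrite (_ : (fun x => _) = fun x => a * F x i j).
  by rewrite vf_actM ?vf_act_cst ?mul0r ?add0r //; exact: smooth_cst.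
by apply/funext => x; rewrite mxE.
Qed.

Lemma mx_actM F G w : smooth_mx F -> smooth_mx G ->
  mx_act (fun x => F x *m G x) w = mx_act F w *m G w + F w *m mx_act G w.
Proof.
move=> sF sG; apply/matrixP => i j; rewrite !mxE -big_split /=.
rewrite (_ : (fun x => _) = fun x => \sum_k F x i k * G x k j).
  rewrite vf_act_sum => [|k]; last exact: smoothM.
  by apply: eq_bigr => k _; rewrite vf_actM // !mxE.
by apply/funext => x; rewrite mxE.
Qed.

Lemma smooth_mxD F G : smooth_mx F -> smooth_mx G ->
  smooth_mx (fun x => F x + G x).
Proof.
move=> sF sG i j; rewrite (_ : (fun x => _) = fun x => F x i j + G x i j).
  exact: smoothD.
by apply/funext => x; rewrite mxE.
Qed.

Lemma smooth_mx_cst (M : 'M[R]_n) : smooth_mx (fun _ : 'rV[R]_n => M).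
Proof. by move=> i j; exact: smooth_cst. Qed.

Lemma smooth_mxZ (a : R) F : smooth_mx F -> smooth_mx (fun x => a *: F x).
Proof.
move=> sF i j; rewrite (_ : (fun x => _) = fun x => a * F x i j).
  by apply: smoothM => //; exact: smooth_cst.
by apply/funext => x; rewrite mxE.
Qed.

Lemma smooth_mxM F G : smooth_mx F -> smooth_mx G ->
  smooth_mx (fun x => F x *m G x).
Proof.
move=> sF sG i j; rewrite (_ : (fun x => _) = fun x => \sum_k F x i k * G x k j).
  by apply: smooth_sum => k; exact: smoothM.
by apply/funext => x; rewrite mxE.
Qed.

Lemma smooth_mx_tr F : smooth_mx F -> smooth_mx (fun x => (F x)^T).
Proof.
move=> sF i j; rewrite (_ : (fun x => _) = fun x => F x j i) //.
by apply/funext => x; rewrite mxE.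
Qed.

Lemma smooth_hessian (l : 'rV[R]_n -> R) : smooth l -> smooth_mx (hessian l).
Proof.
move=> sl i j; rewrite (_ : (fun x => _) = pd i (pd j l)).
  by do 2 apply: smooth_pd.
by apply/funext => x; rewrite mxE.
Qed.

Lemma hessianE (l : 'rV[R]_n -> R) w i j : hessian l w i j = pd i (pd j l) w.
Proof. by rewrite mxE. Qed.

Lemma hessian_sym (l : 'rV[R]_n -> R) w : smooth l -> (hessian l w)^T = hessian l w.
Proof.
by move=> sl; apply/matrixP => i j; rewrite !mxE; exact: smooth_pd_comm.
Qed.

End VectorFieldAction.

(* [A'], [W'], [gB'] and [Phi'] stand for transposes. *)
Lemma helmholtz_identity (R : realType) (n : nat)
    (A A' W W' K mu L X gB gB' gK gL Phi Phi' : 'M[R]_n) :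
  gK = - (2^-1 *: ((A - W) *m K)) - 2^-1 *: (K *m (A' - W')) ->
  mu + L = 2^-1 *: ((A + W) *m K - K *m (A' + W')) ->
  gL = 2^-1 *: (gB *m K + (A + W) *m gK - (gK *m (A' + W') + K *m gB')) ->
  gL = W *m L + L *m W' + X ->
  Phi = 2^-1 *: gB - 4^-1 *: (A *m A) - (3 / 4) *: (W *m A)
        + 4^-1 *: (A *m W) - 4^-1 *: (W *m W) ->
  Phi' = 2^-1 *: gB' - 4^-1 *: (A' *m A') - (3 / 4) *: (A' *m W')
        + 4^-1 *: (W' *m A') - 4^-1 *: (W' *m W') ->
  Phi *m K - K *m Phi' = X - W *m mu - mu *m W'.
Proof.
move=> eK eL eg eX -> ->.
(* Solving for [X] and [L] and substituting leaves an identity in [A], [W], their primed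
   counterparts, [K], [mu], [gB] and [gB'] alone. *)
have {}eX : X = gL - W *m L - L *m W'.
  by rewrite eX; apply/matrixP => i j; rewrite !mxE; ring.
have {}eL : L = 2^-1 *: ((A + W) *m K - K *m (A' + W')) - mu.
  by rewrite -eL addrAC subrr add0r.
rewrite {}eX {}eg {}eL {}eK.
do 4 (rewrite ?(mulmxDl, mulmxDr, mulNmx, mulmxN);
      rewrite -?scalemxAl -?scalemxAr).
rewrite !mulmxA.
(* Once expanded, both sides are linear combinations of noncommutative monomials. Making each
   monomial opaque reduces the claim to comparing scalar coefficients entry by entry. *)
move: (gB *m K) (K *m gB') (W *m mu) (mu *m W').
move: (A *m A *m K) (W *m A *m K) (A *m W *m K) (W *m W *m K).
move: (K *m A' *m A') (K *m A' *m W') (K *m W' *m A') (K *m W' *m W').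
move: (A *m K *m A') (A *m K *m W') (W *m K *m A') (W *m K *m W').
move=> *; apply/matrixP => i j; rewrite !mxE.
by field.
Qed.

(** * The adjoint action and the Jacobi identity in matrix form *)

Section LieAlgebra.
Variables (R : realType) (n : nat) (C : 'I_n -> 'I_n -> 'I_n -> R).

(* [ad_mx x] is the matrix of [{x, -}] acting on row vectors, and [lie_form p]
   the alternating form [(x, y) |-> p({x, y})] of a covector [p]. *)
Definition ad_mx (x : 'rV[R]_n) : 'M[R]_n :=
  \matrix_(m, b) \sum_j x 0 j * C j m b.

Definition lie_form (p : 'rV[R]_n) : 'M[R]_n :=
  \matrix_(m, i) \sum_j C m i j * p 0 j.

Lemma lie_formD p q : lie_form (p + q) = lie_form p + lie_form q.
Proof.
apply/matrixP => m i; rewrite !mxE -big_split; apply: eq_bigr => j _ /=.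
by rewrite mxE mulrDr.
Qed.

Hypothesis C_anti : forall i j a, C i j a = - C j i a.
Hypothesis C_jacobi : forall i j k m,
  \sum_a (C j k a * C i a m + C k i a * C j a m + C i j a * C k a m) = 0.

Lemma lie_form_anti p : (lie_form p)^T = - lie_form p.
Proof.
apply/matrixP => m i; rewrite !mxE -sumrN; apply: eq_bigr => j _.
by rewrite C_anti mulNr.
Qed.

(** [p *m (ad_mx x)^T] is the covector [y |-> p({x, y})], so this is the Jacobi identity
    [{x, {y, z}} = {{x, y}, z} + {y, {x, z}}] with [p] applied. *)
Lemma lie_form_coad p x :
  lie_form (p *m (ad_mx x)^T) =
  ad_mx x *m lie_form p + lie_form p *m (ad_mx x)^T.
Proof.
apply/matrixP => m i; rewrite !mxE -big_split /=.
(* Both sides are brought to sums of [p 0 a * x 0 b] times an expression in structure constants, so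
   that the Jacobi identity applies coefficient by coefficient. *)
transitivity (\sum_a \sum_b p 0 a * x 0 b * \sum_c C m i c * C b c a).
  transitivity (\sum_c \sum_a \sum_b p 0 a * x 0 b * (C m i c * C b c a)).
    apply: eq_bigr => c _; rewrite mxE mulr_sumr; apply: eq_bigr => a _.
    rewrite !mxE !mulr_sumr; apply: eq_bigr => b _; ring.
  rewrite exchange_big; apply: eq_bigr => a _ /=.
  by rewrite exchange_big; apply: eq_bigr => b _ /=; rewrite mulr_sumr.
transitivity (\sum_a \sum_b p 0 a * x 0 b *
    \sum_c (C b m c * C c i a + C m c a * C b i c)).
  apply: eq_bigr => a _; apply: eq_bigr => b _; congr (_ * _).
  apply: subr0_eq; rewrite -sumrB -[RHS](C_jacobi b m i a).
  apply: eq_bigr => c _; rewrite (C_anti i b) (C_anti i c); ring.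
transitivity (\sum_c \sum_a \sum_b
    p 0 a * x 0 b * (C b m c * C c i a + C m c a * C b i c)).
  rewrite [RHS]exchange_big; apply: eq_bigr => a _ /=.
  by rewrite [RHS]exchange_big; apply: eq_bigr => b _ /=; rewrite mulr_sumr.
apply: eq_bigr => c _; rewrite !mxE !mulr_suml exchange_big /=.
transitivity (\sum_b \sum_a x 0 b * C b m c * (C c i a * p 0 a)
   + \sum_a \sum_b C m c a * p 0 a * (x 0 b * C b i c)).
  rewrite [X in _ = _ + X]exchange_big -big_split /=; apply: eq_bigr => b _.
  by rewrite -big_split; apply: eq_bigr => a _ /=; ring.
by congr (_ + _); rewrite ?mulr_suml; apply: eq_bigr => a _; rewrite mulr_sumr.
Qed.

End LieAlgebra.

(** * Antisymmetry and Jacobi identity of structure constants *)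

Section StructureConstants.
Variables (R : realType) (g : vectType R) (br : g -> g -> g).
Hypothesis hbr : lie_bracket br.
Variables (n : nat) (E : n.-tuple g).
Hypothesis hE : basis_of fullv E.
Variable C : 'I_n -> 'I_n -> 'I_n -> R.
Hypothesis hC : forall i j, br (tnth E i) (tnth E j) = \sum_k C i j k *: tnth E k.

Let basis_inj (a : 'I_n -> R) : \sum_k a k *: tnth E k = 0 -> forall k, a k = 0.
Proof.
have /freeP fE := basis_free hE.
move=> Ea; apply: fE; rewrite -[RHS]Ea; apply: eq_bigr => k _.
by rewrite (tnth_nth 0).
Qed.

Let br_sumr x (a : 'I_n -> R) :
  br x (\sum_k a k *: tnth E k) = \sum_k a k *: br x (tnth E k).
Proof.
have [_ r _ _] := hbr.
have br0r : br x 0 = 0.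
  have := r 1 0 0 x; rewrite !scale1r addr0 => /eqP.
  by rewrite -subr_eq0 opprD addNKr oppr_eq0 => /eqP.
elim/big_rec2: _ => // k y1 y2 _ <-; exact: r.
Qed.

Lemma structure_constants_anti i j a : C i j a = - C j i a.
Proof.
have [l r alt _] := hbr.
have anti x y : br x y = - br y x.
  apply/eqP; rewrite -addr_eq0; have := alt (x + y).
  have addl u v z : br (u + v) z = br u z + br v z.
    by have := l 1 u v z; rewrite !scale1r.
  have addr' u v z : br z (u + v) = br z u + br z v.
    by have := r 1 u v z; rewrite !scale1r.
  by rewrite addl !addr' !alt add0r addr0 => ->.
apply/eqP; rewrite -addr_eq0; apply/eqP.
apply: (basis_inj (a := fun a => C i j a + C j i a)).
under eq_bigr do rewrite scalerDl.
by rewrite big_split /= -!hC anti addNr.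
Qed.

Lemma structure_constants_jacobi i j k m :
  \sum_a (C j k a * C i a m + C k i a * C j a m + C i j a * C k a m) = 0.
Proof.
have [_ _ _ jac] := hbr.
have brE p q s : br (tnth E p) (br (tnth E q) (tnth E s)) =
    \sum_b (\sum_a C q s a * C p a b) *: tnth E b.
  rewrite hC br_sumr; under eq_bigr do rewrite hC scaler_sumr.
  rewrite exchange_big; apply: eq_bigr => b _ /=; rewrite scaler_suml.
  by apply: eq_bigr => a _; rewrite scalerA.
rewrite !big_split /=.
apply: (basis_inj (a := fun m => \sum_a C j k a * C i a m
  + \sum_a C k i a * C j a m + \sum_a C i j a * C k a m)).
under eq_bigr do rewrite !scalerDl.
by rewrite !big_split /= -!brE jac.
Qed.

End StructureConstants.

(** * The Euler-Poincaré defect and the Helmholtz data in matrix form *)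

Section EulerPoincare.
Variables (R : realType) (n : nat) (C : 'I_n -> 'I_n -> 'I_n -> R).
Variable gamma : 'rV[R]_n -> 'rV[R]_n.
Hypothesis smooth_gamma : smooth_vf gamma.
Implicit Types (l : 'rV[R]_n -> R) (k : 'rV[R]_n -> 'M[R]_n) (w : 'rV[R]_n).

Local Notation W := (ad_mx C).

(** Here and in [lambda_mx] and [phi_mx] the row is the lower index and the column the upper one, as
    for [ad_mx]; [jac] is the matrix A. *)
Definition jac w : 'M[R]_n := \matrix_(m, a) pd m (fun x => gamma x 0 a) w.
Definition lambda_mx w : 'M[R]_n := \matrix_(i, b) lambda C gamma b i w.
Definition phi_mx w : 'M[R]_n := \matrix_(j, a) phi C gamma a j w.
Definition grad l w : 'rV[R]_n := \row_j pd j l w.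

Lemma lambda_mxE w : lambda_mx w = - (2^-1 *: (jac w - W w)).
Proof. by apply/matrixP => i b; rewrite !mxE. Qed.

Lemma tr_lambda_mx w :
  (lambda_mx w)^T = - (2^-1 *: ((jac w)^T - (W w)^T)).
Proof. by rewrite lambda_mxE; apply/matrixP => i j; rewrite !mxE. Qed.

Lemma tr_jacD w : (jac w + W w)^T = (jac w)^T + (W w)^T.
Proof. exact: linearD. Qed.

Lemma smooth_jac : smooth_mx jac.
Proof.
move=> i j; rewrite (_ : (fun x => _) = pd i (fun x => gamma x 0 j)).
  exact: smooth_pd.
by apply/funext => x; rewrite mxE.
Qed.

Lemma smooth_ad_mx : smooth_mx W.
Proof.
move=> i j; rewrite (_ : (fun x => _) = fun x : 'rV[R]_n => \sum_a x 0 a * C a i j).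
  apply: smooth_sum => a; apply: smoothM; last exact: smooth_cst.
  exact: smooth_coord.
by apply/funext => x; rewrite mxE.
Qed.

Lemma vf_act_coord j w : vf_act gamma (fun x => x 0 j) w = gamma w 0 j.
Proof.
rewrite /vf_act (bigD1 j) //= pd_coord eqxx mulr1 big1 ?addr0 // => i.
by rewrite pd_coord => /negbTE->; rewrite mulr0.
Qed.

Lemma mx_act_ad w : mx_act gamma W w = W (gamma w).
Proof.
apply/matrixP => i b; rewrite !mxE.
rewrite (_ : (fun x => _) = fun x : 'rV[R]_n => \sum_a x 0 a * C a i b); last first.
  by apply/funext => x; rewrite mxE.
rewrite vf_act_sum => [|a]; last first.
  by apply: smoothM; [exact: smooth_coord|exact: smooth_cst].
apply: eq_bigr => a _; rewrite vf_actM; last 2 first.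
- exact: smooth_coord.
- exact: smooth_cst.
by rewrite vf_act_cst mulr0 addr0 vf_act_coord.
Qed.

Lemma lie_form_gradE l : smooth l -> forall i j,
  (fun x => lie_form C (grad l x) i j) = fun x => \sum_a C i j a * pd a l x.
Proof.
move=> sl i j; apply/funext => x; rewrite mxE; apply: eq_bigr => a _.
by rewrite mxE.
Qed.

Lemma smooth_lie_form_grad l : smooth l ->
  smooth_mx (fun x => lie_form C (grad l x)).
Proof.
move=> sl i j; rewrite lie_form_gradE //; apply: smooth_sum => a.
by apply: smoothM; [exact: smooth_cst|exact: smooth_pd].
Qed.

Lemma mx_act_lie_form_grad l w : smooth l ->
  mx_act gamma (fun x => lie_form C (grad l x)) w =
  lie_form C (\row_j vf_act gamma (pd j l) w).
Proof.
move=> sl; apply/matrixP => i j; rewrite mxE lie_form_gradE // mxE.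
rewrite vf_act_sum => [|a]; last first.
  by apply: smoothM; [exact: smooth_cst|exact: smooth_pd].
apply: eq_bigr => a _; rewrite mxE vf_actM; last 2 first.
- exact: smooth_cst.
- exact: smooth_pd.
by rewrite vf_act_cst mul0r add0r.
Qed.

(** The definition of the defect read as an evolution equation for [grad l]: a coadjoint term, to
    which [lie_form_coad] applies, plus the defect. *)
Lemma vf_act_grad l w : \row_j vf_act gamma (pd j l) w =
  grad l w *m (W w)^T + \row_i EP_defect C gamma l i w.
Proof.
apply/rowP => i; rewrite !mxE /EP_defect.
rewrite (_ : \sum_j (grad l w) 0 j * _ =
   \sum_j \sum_b C b i j * w 0 b * pd j l w); first by rewrite addrCA subrr addr0.
apply: eq_bigr => j _; rewrite !mxE mulrC mulr_suml.
by apply: eq_bigr => b _; rewrite mulrC [w 0 b * _]mulrC mulrC.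
Qed.

(** Each sum in [phi] is an entry of a matrix product. Since [ad_mx] is linear in its argument,
    [W (gamma w)] is the derivative of [W] along gamma, which merges the first two terms into the
    derivative of A + W. *)
Lemma phi_mxE w : phi_mx w =
  2^-1 *: mx_act gamma (fun x => jac x + W x) w - 4^-1 *: (jac w *m jac w)
  - (3 / 4) *: (W w *m jac w) + 4^-1 *: (jac w *m W w)
  - 4^-1 *: (W w *m W w).
Proof.
rewrite mx_actD; [|exact: smooth_jac|exact: smooth_ad_mx].
rewrite mx_act_ad scalerDr.
apply/matrixP => j a; rewrite [LHS]mxE /phi.
have -> : \sum_i gamma w 0 i * pd i (pd j (fun x => gamma x 0 a)) w =
    mx_act gamma jac w j a.
  rewrite mxE (_ : (fun x => jac x j a) = pd j (fun x => gamma x 0 a)) //.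
  by apply/funext => x; rewrite mxE.
have -> : \sum_i gamma w 0 i * C i j a = W (gamma w) j a by rewrite mxE.
have -> : \sum_i pd j (fun x => gamma x 0 i) w * pd i (fun x => gamma x 0 a) w =
    (jac w *m jac w) j a.
  by rewrite mxE; apply: eq_bigr => i _; rewrite !mxE.
have -> : 3 / 4 * \sum_i \sum_b C i j b * w 0 i * pd b (fun x => gamma x 0 a) w =
    3 / 4 * (W w *m jac w) j a.
  rewrite mxE exchange_big; congr (_ * _); apply: eq_bigr => b _.
  rewrite !mxE mulr_suml.
  by apply: eq_bigr => i _; rewrite [C _ _ _ * _]mulrC.
have -> : \sum_i \sum_b w 0 i * C i b a * pd j (fun x => gamma x 0 b) w =
    (jac w *m W w) j a.
  rewrite mxE exchange_big; apply: eq_bigr => b _.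
  by rewrite !mxE mulr_sumr; apply: eq_bigr => i _; rewrite mulrC.
have -> : \sum_p \sum_q \sum_b w 0 p * w 0 q * C p j b * C q b a =
    (W w *m W w) j a.
  rewrite mxE; under eq_bigr do rewrite exchange_big.
  rewrite exchange_big; apply: eq_bigr => b _.
  rewrite !mxE mulr_suml; apply: eq_bigr => p _.
  rewrite mulr_sumr; apply: eq_bigr => q _.
  by rewrite mulrACA mulrA.
by rewrite !(mxE _ _ j a).
Qed.

Lemma pd_EP_defect l w : smooth l ->
  \matrix_(m, i) pd m (EP_defect C gamma l i) w =
  jac w *m hessian l w - lie_form C (grad l w) - hessian l w *m (W w)^T
  + mx_act gamma (hessian l) w.
Proof.
move=> sl; apply/matrixP => m i; rewrite !mxE.
have sp j : smooth (pd j l) by exact: smooth_pd.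
have st j b : smooth (fun x : 'rV[R]_n => C b i j * x 0 b * pd j l x).
  apply: smoothM => //; apply: smoothM; first exact: smooth_cst.
  exact: smooth_coord.
rewrite /EP_defect pdB; last 2 first.
- exact: smooth_vf_act.
- by apply: smooth_sum => j; apply: smooth_sum => b.
rewrite /vf_act pd_sum => [|a]; last by apply: smoothM => //; exact: smooth_pd.
rewrite pd_sum => [|j]; last by apply: smooth_sum => b.
have -> : \sum_a pd m (fun x => gamma x 0 a * pd a (pd i l) x) w =
    \sum_j jac w m j * hessian l w j i + \sum_a gamma w 0 a *
      pd a (fun x => hessian l x m i) w.
  rewrite -big_split; apply: eq_bigr => a _ /=.
  rewrite pdM //; last exact: smooth_pd.
  have -> : (fun x => hessian l x m i) = pd m (pd i l).
    by apply/funext => x; rewrite mxE.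
  by rewrite (smooth_pd_comm m a w (sp i)) ![_ _ _ m _]mxE [hessian _ _ _ _]mxE.
have -> : \sum_j pd m (fun x => \sum_b C b i j * x 0 b * pd j l x) w =
    \sum_j C m i j * grad l w 0 j + \sum_j hessian l w m j * (W w)^T j i.
  rewrite -big_split; apply: eq_bigr => j _ /=; rewrite pd_sum //.
  (* Only for [b = m] does differentiating [x 0 b] contribute; that term is the entry of
     [lie_form]. *)
  rewrite !mxE mulr_sumr (bigD1 m) //= [X in _ = _ + X](bigD1 m) //=.
  have dt b : pd m (fun x => C b i j * x 0 b * pd j l x) w =
      C b i j * (m == b)%:R * pd j l w + C b i j * w 0 b * pd m (pd j l) w.
    rewrite pdM //; last by apply: smoothM;
      [exact: smooth_cst|exact: smooth_coord].
    rewrite pdM; [|exact: smooth_cst|exact: smooth_coord].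
    by rewrite pd_cst mul0r add0r pd_coord.
  rewrite dt eqxx mulr1 -addrA; congr (_ + (_ + _)); first by ring.
  apply: eq_bigr => b bm; rewrite dt [m == b]eq_sym (negbTE bm).
  by rewrite mulr0 mul0r add0r; ring.
ring.
Qed.

Lemma helmholtz_lambdaP k w :
  (forall i j, vf_act gamma (fun x => k x i j) w
      - \sum_b k w b j * lambda C gamma b i w
      - \sum_b k w i b * lambda C gamma b j w = 0) <->
  mx_act gamma k w = lambda_mx w *m k w + k w *m (lambda_mx w)^T.
Proof.
have E1 i j : (lambda_mx w *m k w) i j = \sum_b k w b j * lambda C gamma b i w.
  by rewrite mxE; apply: eq_bigr => b _; rewrite mxE mulrC.
have E2 i j : (k w *m (lambda_mx w)^T) i j = \sum_b k w i b * lambda C gamma b j w.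
  by rewrite mxE; apply: eq_bigr => b _; rewrite !mxE.
split=> [H|H i j].
  apply/matrixP => i j; rewrite [LHS]mxE [RHS]mxE E1 E2; apply: subr0_eq.
  by rewrite opprD addrA H.
by have /matrixP/(_ i j) := H; rewrite [LHS]mxE [RHS]mxE E1 E2 => ->; ring.
Qed.

(** Substituting the second Helmholtz condition for the derivative of K turns A K - K W^T into half
    of (A + W) K minus its transpose. Since [hessian l w] is symmetric, this makes the defect's
    derivative antisymmetric as soon as [C] is. *)
Lemma pd_EP_defect_helmholtz l w : smooth l ->
  mx_act gamma (hessian l) w = lambda_mx w *m hessian l w
    + hessian l w *m (lambda_mx w)^T ->
  \matrix_(m, i) pd m (EP_defect C gamma l i) w =
  2^-1 *: ((jac w + W w) *m hessian l w - hessian l w *m (jac w + W w)^T)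
  - lie_form C (grad l w).
Proof.
move=> sl H; rewrite pd_EP_defect // H tr_lambda_mx lambda_mxE tr_jacD.
do 3 (rewrite ?(mulmxDl, mulmxDr, mulNmx, mulmxN);
      rewrite -?scalemxAl -?scalemxAr).
move: (jac w *m _) (W w *m _) (_ *m (jac w)^T) (_ *m (W w)^T) (lie_form _ _).
by move=> *; apply/matrixP => i j; rewrite !mxE; field.
Qed.

End EulerPoincare.

(** * The identity linking the third Helmholtz condition to the cocycle conditions *)

Section Obstruction.
Variables (R : realType) (n : nat) (C : 'I_n -> 'I_n -> 'I_n -> R).
Hypothesis C_anti : forall i j a, C i j a = - C j i a.
Hypothesis C_jacobi : forall i j k m,
  \sum_a (C j k a * C i a m + C k i a * C j a m + C i j a * C k a m) = 0.
Variable gamma : 'rV[R]_n -> 'rV[R]_n.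
Hypothesis smooth_gamma : smooth_vf gamma.
Implicit Types (l : 'rV[R]_n -> R) (k : 'rV[R]_n -> 'M[R]_n) (w : 'rV[R]_n).

Local Notation W := (ad_mx C).
Local Notation lam := (lambda_mx C gamma).
Local Notation Phi := (phi_mx C gamma).
Local Notation D := (EP_defect C gamma).

Lemma smooth_EP_defect l i : smooth l -> smooth (D l i).
Proof.
move=> sl; apply: smoothB.
  by apply: smooth_vf_act => //; exact: smooth_pd.
apply: smooth_sum => j; apply: smooth_sum => b.
apply: smoothM; last exact: smooth_pd.
by apply: smoothM; [exact: smooth_cst|exact: smooth_coord].
Qed.

Lemma pd_affine (a : 'I_n -> R) (c : R) m w :
  pd m (fun x => \sum_j a j * x 0 j + c) w = a m.
Proof.
have sa j : smooth (fun x : 'rV[R]_n => a j * x 0 j).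
  by apply: smoothM; [exact: smooth_cst|exact: smooth_coord].
rewrite pdD; [|exact: smooth_sum|exact: smooth_cst].
rewrite pd_cst addr0 pd_sum // (bigD1 m) //= big1 => [|j jm].
  rewrite pdM; [|exact: smooth_cst|exact: smooth_coord].
  by rewrite pd_cst mul0r add0r pd_coord eqxx mulr1 addr0.
rewrite pdM; [|exact: smooth_cst|exact: smooth_coord].
by rewrite pd_cst mul0r add0r pd_coord eq_sym (negbTE jm) mulr0.
Qed.

Lemma smooth_affine (a : 'I_n -> R) (c : R) :
  smooth (fun x : 'rV[R]_n => \sum_j a j * x 0 j + c).
Proof.
apply: smoothD; last exact: smooth_cst.
apply: smooth_sum => j.
by apply: smoothM; [exact: smooth_cst|exact: smooth_coord].
Qed.

(** The derivative along gamma of the form [lie_form C (grad l x)] is computed twice: from its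
    expression through the Hessian, and from the evolution of [grad l]. Comparing the two leaves the
    failure of the third condition on the left and the coboundary terms of [mu] and [nu] on the
    right. *)
Lemma helmholtz_obstruction l (mu : 'M[R]_n) (nu : 'rV[R]_n) w :
  smooth l ->
  (forall x, mx_act gamma (hessian l) x =
     lam x *m hessian l x + hessian l x *m (lam x)^T) ->
  (forall i x, D l i x = \sum_j mu j i * x 0 j + nu 0 i) ->
  Phi w *m hessian l w - hessian l w *m (Phi w)^T =
  lie_form C (w *m mu + nu) - W w *m mu - mu *m (W w)^T.
Proof.
move=> sl HK HD.
have DE i : D l i = fun x => \sum_j mu j i * x 0 j + nu 0 i.
  by apply/funext => x.
have symK x := hessian_sym x sl.
(* As the Hessian is symmetric, [mu + lie_form C (grad l x)] is the antisymmetric part of [F x]. *)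
pose F x := (jac gamma x + W x) *m hessian l x.
have FtE x : (F x)^T = hessian l x *m (jac gamma x + W x)^T.
  by rewrite trmx_mul symK.
have key x : mu + lie_form C (grad l x) = 2^-1 *: (F x - (F x)^T).
  rewrite FtE -[RHS](subrK (lie_form C (grad l x))).
  rewrite -pd_EP_defect_helmholtz //; congr (_ + _).
  by apply/matrixP => m i; rewrite mxE DE pd_affine.
have sB : smooth_mx (fun x => jac gamma x + W x).
  by apply: smooth_mxD; [exact: smooth_jac|exact: smooth_ad_mx].
have sF : smooth_mx F by apply: smooth_mxM => //; exact: smooth_hessian.
have symgK : (mx_act gamma (hessian l) w)^T = mx_act gamma (hessian l) w.
  by rewrite -mx_act_tr; congr mx_act; apply/funext => x; exact: symK.
pose gL := lie_form C (\row_j vf_act gamma (pd j l) w).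
have gLE : gL = 2^-1 *: (mx_act gamma F w - (mx_act gamma F w)^T).
  have -> : gL = mx_act gamma (fun x => mu + lie_form C (grad l x)) w.
    rewrite mx_actD; [|exact: smooth_mx_cst|exact: smooth_lie_form_grad].
    by rewrite mx_act_cst add0r mx_act_lie_form_grad.
  rewrite (_ : (fun x => mu + _) = fun x => 2^-1 *: (F x + -1 *: (F x)^T)).
    have sF' : smooth_mx (fun x => -1 *: (F x)^T).
      by apply: smooth_mxZ; exact: smooth_mx_tr.
    rewrite mx_actZ; last exact: smooth_mxD.
    rewrite mx_actD // mx_actZ; last exact: smooth_mx_tr.
    by rewrite mx_act_tr scaleN1r.
  by apply/funext => x; rewrite scaleN1r key.
apply: (@helmholtz_identity _ _ (jac gamma w) (jac gamma w)^T (W w) (W w)^T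
  (hessian l w) mu (lie_form C (grad l w)) _
  (mx_act gamma (fun x => jac gamma x + W x) w)
  (mx_act gamma (fun x => jac gamma x + W x) w)^T
  (mx_act gamma (hessian l) w) gL).
- by rewrite HK tr_lambda_mx lambda_mxE mulNmx mulmxN -scalemxAl -scalemxAr.
- by rewrite key FtE tr_jacD.
- rewrite gLE /F mx_actM //; last exact: smooth_hessian.
  rewrite (_ : forall X Y : 'M[R]_n, (X + Y)^T = X^T + Y^T); last exact: linearD.
  by rewrite !trmx_mul symK symgK tr_jacD [hessian l w *m _ + _]addrC.
(* The coadjoint term of the evolution gives W L + L W^T; the defect, being [w *m mu + nu], gives
   the term [X]. *)
- rewrite /gL (vf_act_grad C) lie_formD lie_form_coad //; congr (_ + lie_form C _).
  apply/rowP => i; rewrite !mxE HD; congr (_ + _); apply: eq_bigr => j _.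
  by rewrite mulrC.
- exact: phi_mxE.
- rewrite phi_mxE //; move: (mx_act _ _ _) => gB.
  rewrite -!trmx_mul; move: (jac gamma w *m jac _ _) (W w *m jac _ _).
  move: (jac _ _ *m W w) (W w *m W w).
  by move=> *; apply/matrixP => i j; rewrite !mxE.
Qed.

End Obstruction.

(** * The classes of a multiplier: existence, cocycle property, uniqueness, vanishing *)

Section MultiplierClasses.
Variables (R : realType) (n : nat) (C : 'I_n -> 'I_n -> 'I_n -> R).
Hypothesis C_anti : forall i j a, C i j a = - C j i a.
Hypothesis C_jacobi : forall i j k m,
  \sum_a (C j k a * C i a m + C k i a * C j a m + C i j a * C k a m) = 0.
Variable gamma : 'rV[R]_n -> 'rV[R]_n.
Hypothesis smooth_gamma : smooth_vf gamma.
Implicit Types (l : 'rV[R]_n -> R) (k : 'rV[R]_n -> 'M[R]_n) (w : 'rV[R]_n).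

Local Notation W := (ad_mx C).
Local Notation lam := (lambda_mx C gamma).
Local Notation Phi := (phi_mx C gamma).
Local Notation D := (EP_defect C gamma).

(** The Poincaré lemma is applied twice: condition (4) makes each column of [k] closed, with
    primitive [p j], and the symmetry of [k] makes the family of the [p j] closed in turn. *)
Lemma multiplier_hessian k : multiplier C gamma k ->
  exists2 l, smooth l & forall w, hessian l w = k w.
Proof.
move=> [sk [kd _ _ kc]].
have : forall j, exists p, smooth p /\ forall i w, pd i p w = k w i j.
  move=> j; have [p sp pE] := poincare_lemma (fun i => sk i j)
    (fun i m w => kc w m j i).
  by exists p.
move=> /choice[p pP]; have [|l sl lP] := poincare_lemma (fun j => (pP j).1).
  by move=> i j w; rewrite !(pP _).2 (kd w).2.
exists l => // w; apply/matrixP => i j; rewrite mxE.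
have -> : pd j l = p j by apply/funext => x; exact: lP.
exact: (pP j).2.
Qed.

Lemma helmholtz_phiP (K : 'M[R]_n) w : K^T = K ->
  (forall j b, \sum_i K i j * phi C gamma i b w
             = \sum_i K i b * phi C gamma i j w) <->
  Phi w *m K = K *m (Phi w)^T.
Proof.
move=> symK.
have E1 b j : (Phi w *m K) b j = \sum_i K i j * phi C gamma i b w.
  by rewrite mxE; apply: eq_bigr => i _; rewrite mxE mulrC.
have E2 b j : (K *m (Phi w)^T) b j = \sum_i K i b * phi C gamma i j w.
  by rewrite mxE; apply: eq_bigr => i _; rewrite -{1}symK !mxE.
split=> [H|H j b]; first by apply/matrixP => b j; rewrite E1 E2.
by rewrite -E1 -E2 H.
Qed.

Lemma multiplier_lambda k w : multiplier C gamma k ->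
  mx_act gamma k w = lam w *m k w + k w *m (lam w)^T.
Proof.
by move=> [_ [_ k2 _ _]]; apply/helmholtz_lambdaP => i j; exact: k2.
Qed.

(* A covector field with antisymmetric derivative is affine: its second
   derivatives are antisymmetric in one pair of indices and symmetric in
   another. *)
Lemma EP_defect_affine l : smooth l ->
  (forall w, mx_act gamma (hessian l) w =
     lam w *m hessian l w + hessian l w *m (lam w)^T) ->
  exists (mu : 'M[R]_n) (nu : 'rV[R]_n), (forall i j, mu i j = - mu j i) /\
    forall i w, D l i w = \sum_j mu j i * w 0 j + nu 0 i.
Proof.
move=> sl HK.
have sD i : smooth (D l i) by exact: smooth_EP_defect.
have anti m i w : pd m (D l i) w = - pd i (D l m) w.
  have E := pd_EP_defect_helmholtz smooth_gamma sl (HK w).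
  have KB : hessian l w *m (jac gamma w + W w)^T =
      ((jac gamma w + W w) *m hessian l w)^T.
    by rewrite trmx_mul (hessian_sym w sl).
  rewrite KB in E; move: (lie_form_anti C_anti (grad l w)) E.
  move: (_ *m _) (lie_form _ _) => M L /matrixP/(_ m i) + /matrixP E.
  by have := E m i; have := E i m; rewrite !mxE => -> -> ->; ring.
have pdpd0 a m i w : pd a (pd m (D l i)) w = 0.
  have swap b c e : pd b (pd c (D l e)) w = - pd b (pd e (D l c)) w.
    have -> : pd c (D l e) = fun x => 0 - pd e (D l c) x.
      by apply/funext => x; rewrite anti sub0r.
    rewrite pdB; [|exact: smooth_cst|by apply: smooth_pd].
    by rewrite pd_cst sub0r.
  have comm b c e : pd b (pd c (D l e)) w = pd c (pd b (D l e)) w.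
    exact: smooth_pd_comm.
  have : pd a (pd m (D l i)) w = - pd a (pd m (D l i)) w.
    (* Three rounds of exchanging the first two indices and then the last two restore the original
       order, with total sign -1. *)
    by rewrite {1}comm swap comm swap comm swap !opprK.
  by move=> E; apply/eqP; rewrite -[_ == 0](mulrn_eq0 _ 2) mulr2n {1}E addNr.
pose mu : 'M[R]_n := \matrix_(m, i) pd m (D l i) 0.
have muE m i w : pd m (D l i) w = mu m i.
  by rewrite mxE; apply: pd0_cst => //; exact: smooth_pd.
exists mu, (\row_i D l i 0); split=> [i j|i w]; first by rewrite -!(muE _ _ 0).
(* The linear part of the defect; the [+ 0] gives it the shape expected by [smooth_affine] and
   [pd_affine]. *)
pose S (x : 'rV[R]_n) := \sum_j mu j i * x 0 j + 0 : R.
have sS : smooth S by exact: smooth_affine.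
have H : D l i w - S w = D l i 0 - S 0.
  apply: (pd0_cst (smoothB (sD i) sS)) => m x.
  by rewrite pdB // pd_affine muE subrr.
have S0 : S 0 = 0.
  by rewrite /S big1 ?addr0 // => j _; rewrite [X in _ * X]mxE mulr0.
rewrite S0 subr0 in H.
by rewrite mxE -H /S addr0 addrC subrK.
Qed.

(** Condition (3) kills the left-hand side of [helmholtz_obstruction]. The remaining affine
    expression vanishes identically: at the origin this is the condition on [nu], at the basis
    vectors the one on [mu]. *)
Lemma multiplier_cocycles k l (mu : 'M[R]_n) (nu : 'rV[R]_n) :
  multiplier C gamma k -> smooth l ->
  (forall w, hessian l w = k w) ->
  (forall i j, mu i j = - mu j i) ->
  (forall i w, D l i w = \sum_j mu j i * w 0 j + nu 0 i) ->
  cocycle1 C nu /\ cocycle2 C mu.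
Proof.
move=> mk sl hk mu_anti HD.
have hkE : hessian l = k by apply/funext.
have obs w : lie_form C (w *m mu + nu) - W w *m mu - mu *m (W w)^T = 0.
  rewrite -(helmholtz_obstruction C_anti C_jacobi smooth_gamma w sl _ HD).
    apply/eqP; rewrite subr_eq0; apply/eqP/helmholtz_phiP => [|j b].
      exact: hessian_sym.
    by have [_ [_ _ k3 _]] := mk; rewrite hkE.
  by rewrite hkE => x; exact: multiplier_lambda.
have W0 : W 0 = 0.
  by apply/matrixP => i j; rewrite !mxE big1 // => a _; rewrite mxE mul0r.
have nu0 : lie_form C nu = 0.
  by have := obs 0; rewrite W0 trmx0 mul0mx mulmx0 mul0mx add0r !subr0.
split=> [i j|].
  have /matrixP/(_ i j) := nu0; rewrite !mxE => H; rewrite -[RHS]H.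
  by apply: eq_bigr => a _; rewrite mulrC.
split=> // i j b.
have /matrixP/(_ j b) := obs (delta_mx 0 i).
rewrite lie_formD nu0 addr0 !mxE => H; rewrite -[RHS]H.
rewrite -!sumrB; apply: eq_bigr => a _; rewrite !mxE.
have delta_sum (F : 'I_n -> R) : \sum_c (delta_mx 0 i : 'rV[R]_n) 0 c * F c = F i.
  rewrite (bigD1 i) //= big1 => [|c ci]; first by rewrite mxE !eqxx mul1r addr0.
  by rewrite mxE (negbTE ci) andbF mul0r.
rewrite !delta_sum (C_anti b i) (mu_anti b a); ring.
Qed.

(** Adding a linear function changes the partials by constants, which gamma annihilates, so only the
    bracket term changes: [mu] moves by a coboundary and [nu] stays. *)
Lemma EP_defect_shift l l' (theta : 'rV[R]_n) i w : smooth l -> smooth l' ->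
  (forall j x, pd j l' x = pd j l x + theta 0 j) ->
  D l' i w = D l i w - \sum_b (\sum_j theta 0 j * C b i j) * w 0 b.
Proof.
move=> sl sl' H; rewrite /EP_defect.
have -> : pd i l' = fun x => pd i l x + theta 0 i by apply/funext => x.
rewrite vf_actD; [|exact: smooth_pd|exact: smooth_cst].
rewrite vf_act_cst addr0 -addrA -opprD; congr (_ - _).
under [X in _ = _ + X]eq_bigr do rewrite mulr_suml.
rewrite [X in _ = _ + X]exchange_big -big_split; apply: eq_bigr => j _ /=.
rewrite -big_split; apply: eq_bigr => b _ /=; rewrite H; ring.
Qed.

Lemma same_hessian l l' : smooth l -> smooth l' ->
  (forall w, hessian l w = hessian l' w) ->
  exists theta : 'rV[R]_n, forall j x, pd j l' x = pd j l x + theta 0 j.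
Proof.
move=> sl sl' H; exists (\row_j (pd j l' 0 - pd j l 0)) => j x.
have := @pd0_cst _ _ (fun x => pd j l' x - pd j l x).
move=> /(_ (smoothB (smooth_pd j sl') (smooth_pd j sl))) E.
rewrite mxE -(E _ x) => [|i w]; first by rewrite addrCA subrr addr0.
rewrite pdB; [|exact: smooth_pd|exact: smooth_pd].
have /matrixP/(_ i j) := H w; rewrite !hessianE => E'.
by apply/eqP; rewrite subr_eq0; apply/eqP; exact: esym E'.
Qed.

Lemma affine_inj (a a' : 'I_n -> R) (c c' : R) :
  (forall w : 'rV[R]_n,
    \sum_j a j * w 0 j + c = \sum_j a' j * w 0 j + c') ->
  (forall j, a j = a' j) /\ c = c'.
Proof.
move=> H; split=> [j|].
  have E : (fun w : 'rV[R]_n => \sum_j a j * w 0 j + c) =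
      (fun w => \sum_j a' j * w 0 j + c') by apply/funext.
  by have := pd_affine a c j 0; rewrite E pd_affine => <-.
by have := H 0; rewrite !big1 ?add0r // => j _; rewrite mxE mulr0.
Qed.

Lemma coboundary2D (mu mu' : 'M[R]_n) :
  coboundary2 C mu -> coboundary2 C mu' -> coboundary2 C (mu + mu').
Proof.
move=> [t Ht] [t' Ht']; exists (t + t') => i j.
rewrite mxE Ht Ht' -big_split; apply: eq_bigr => b _ /=.
by rewrite mxE mulrDl.
Qed.

Lemma coboundary2N (mu : 'M[R]_n) : coboundary2 C mu -> coboundary2 C (- mu).
Proof.
move=> [t Ht]; exists (- t) => i j.
by rewrite mxE Ht -sumrN; apply: eq_bigr => b _; rewrite mxE mulNr.
Qed.

Lemma class2_eq (mu mu' : 'M[R]_n) :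
  class2 C mu = class2 C mu' <-> coboundary2 C (mu - mu').
Proof.
split=> [E|H].
  suff : class2 C mu' mu by [].
  rewrite -E /class2 /= subrr; exists 0 => i j.
  by rewrite mxE big1 // => b _; rewrite mxE mul0r.
apply/seteqP; split=> nu; rewrite /class2 /= => Hnu.
  by rewrite -(subrKA mu); exact: coboundary2D.
rewrite -(subrKA mu'); apply: coboundary2D => //.
by rewrite -opprB; exact: coboundary2N.
Qed.

(** Functions with the same Hessian have gradients differing by a constant [theta].
    [EP_defect_shift] then compares their defects, and the coefficients of an affine function are
    determined by it. *)
Lemma multiplier_classes_unique k c c' :
  multiplier_classes C gamma k c -> multiplier_classes C gamma k c' -> c = c'.
Proof.
move=> [l [mu [nu [sl hl _ Dl ->]]]] [l' [mu' [nu' [sl' hl' _ Dl' ->]]]].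
have [|theta H] := same_hessian sl sl'; first by move=> w; rewrite hl hl'.
have E i w : \sum_j mu' j i * w 0 j + nu' 0 i =
    \sum_j (mu j i - \sum_b theta 0 b * C j i b) * w 0 j + nu 0 i.
  rewrite -Dl' (EP_defect_shift i w sl sl' H) Dl addrAC; congr (_ + _).
  by rewrite -sumrB; apply: eq_bigr => j _; rewrite mulrBl.
have -> : nu = nu' by apply/rowP => i; have [] := affine_inj (E i).
congr (_, _); apply/class2_eq; exists theta => i j.
by have [/(_ i) H1 _] := affine_inj (E j); rewrite !mxE H1 opprB addrC subrK.
Qed.

(** The derivative of a zero defect is zero, and its symmetric part is condition (2). Condition (3)
    is then [helmholtz_obstruction] with [mu = 0] and [nu = 0]; condition (4) is the symmetry of
    third derivatives. *)
Lemma EP_lagrangian_multiplier l : EP_lagrangian C gamma l ->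
  multiplier C gamma (hessian l) /\
  multiplier_classes C gamma (hessian l) (0, class2 C 0).
Proof.
move=> [sl dl D0].
have symK w : (hessian l w)^T = hessian l w by exact: hessian_sym.
have HD i w : D l i w = \sum_j (0 : 'M[R]_n) j i * w 0 j + (0 : 'rV[R]_n) 0 i.
  by rewrite D0 mxE big1 ?addr0 // => j _; rewrite mxE mul0r.
have HK w : mx_act gamma (hessian l) w =
    lam w *m hessian l w + hessian l w *m (lam w)^T.
  have pd0 : \matrix_(m, i) pd m (D l i) w = 0.
    apply/matrixP => m i; rewrite !mxE (_ : D l i = fun=> 0) ?pd_cst //.
    by apply/funext => x.
  have symgK : (mx_act gamma (hessian l) w)^T = mx_act gamma (hessian l) w.
    by rewrite -mx_act_tr; congr mx_act; apply/funext.
  have := pd_EP_defect C smooth_gamma w sl; rewrite pd0.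
  have antiL := lie_form_anti C_anti (grad l w).
  have trAK : (jac gamma w *m hessian l w)^T = hessian l w *m (jac gamma w)^T.
    by rewrite trmx_mul symK.
  have trWK : (W w *m hessian l w)^T = hessian l w *m (W w)^T.
    by rewrite trmx_mul symK.
  rewrite tr_lambda_mx lambda_mxE !(mulNmx, mulmxN) -?scalemxAl -?scalemxAr.
  rewrite mulmxBl mulmxBr -trAK -trWK.
  move: (mx_act _ _ _) symgK (lie_form _ _) antiL => gK symgK L antiL.
  move: (jac _ _ *m _) (W _ *m _) => X Y E.
  apply/matrixP => i j.
  (* Adding the entries [(i, j)] and [(j, i)] eliminates the antisymmetric [L] and doubles the
     symmetric [gK]. *)
  have /matrixP/(_ i j) := E; have /matrixP/(_ j i) := E.
  have /matrixP/(_ i j) := symgK; have /matrixP/(_ i j) := antiL.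
  rewrite !mxE => -> -> E1 E2; lra.
split; last by exists l, 0, 0; split=> // i j; rewrite !mxE oppr0.
split; first exact: smooth_hessian.
split.
- by move=> w; split=> // i j; rewrite -{1}symK mxE.
- by move=> w; apply/helmholtz_lambdaP.
- move=> w; apply/helmholtz_phiP => //; apply: subr0_eq.
  rewrite (helmholtz_obstruction C_anti C_jacobi smooth_gamma w sl HK HD).
  rewrite mulmx0 addr0 mulmx0 mul0mx !subr0.
  by apply/matrixP => p q; rewrite !mxE big1 // => a _; rewrite mxE mulr0.
- move=> w i j m.
  have hE p q : (fun x => hessian l x p q) = pd p (pd q l).
    by apply/funext => x; rewrite mxE.
  by rewrite !hE; apply: smooth_pd_comm; exact: smooth_pd.
Qed.

Lemma EP_lagrangian_classesP k : multiplier C gamma k ->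
  (exists l, EP_lagrangian C gamma l /\ forall w, hessian l w = k w) <->
  multiplier_classes C gamma k (0, class2 C 0).
Proof.
move=> [_ [kd _ _ _]]; split=> [[l [El hk]]|].
  have [_] := EP_lagrangian_multiplier El.
  by rewrite (_ : hessian l = k) //; apply/funext.
move=> [l [mu [nu [sl hl mu_anti Dl [nu0 /esym/class2_eq]]]]].
rewrite subr0 => -[theta Htheta].
(* [theta] is a primitive of the coboundary [mu], so adding this linear term cancels the whole
   defect while preserving the Hessian. *)
pose l' (x : 'rV[R]_n) := l x + (\sum_j theta 0 j * x 0 j + 0).
have sa : smooth (fun x : 'rV[R]_n => \sum_j theta 0 j * x 0 j + 0).
  exact: smooth_affine.
have sl' : smooth l' by exact: smoothD.
have H j x : pd j l' x = pd j l x + theta 0 j by rewrite pdD // pd_affine.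
have hl' w : hessian l' w = k w.
  rewrite -hl; apply/matrixP => i j; rewrite !hessianE.
  have -> : pd j l' = fun x => pd j l x + theta 0 j by apply/funext.
  rewrite pdD; [|exact: smooth_pd|exact: smooth_cst].
  by rewrite pd_cst addr0.
exists l'; split=> //; split=> // [w|i w]; first by rewrite hl' (kd w).1.
rewrite (EP_defect_shift i w sl sl' H) Dl -nu0 mxE addr0 -sumrB big1 // => j _.
by rewrite Htheta subrr.
Qed.

End MultiplierClasses.

(** * The cohomological criterion for derivability from a Lagrangian *)

Unset Implicit Arguments.

(** Vanishing is stated as [(0, class2 C 0)] being the pair of classes, which is unambiguous by the
    uniqueness in the first clause. The second clause fixes the multiplier and asks for a Lagrangian
    with that Hessian; the third lets the multiplier vary. *)
Theorem theorem4 (R : realType) (g : vectType R) (br : g -> g -> g)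
    (hbr : lie_bracket br)
    (n : nat) (E : n.-tuple g) (hE : basis_of fullv E)
    (C : 'I_n -> 'I_n -> 'I_n -> R)
    (hC : forall i j, br (tnth E i) (tnth E j) = \sum_k C i j k *: tnth E k)
    (gamma : 'rV[R]_n -> 'rV[R]_n) (hgamma : smooth_vf gamma) :
  [/\ forall k, multiplier C gamma k ->
        (exists! c, multiplier_classes C gamma k c) /\
        (forall c, multiplier_classes C gamma k c -> H1 C c.1 /\ H2 C c.2),
      forall k, multiplier C gamma k ->
        ((exists l, EP_lagrangian C gamma l /\ forall w, hessian l w = k w)
         <-> multiplier_classes C gamma k (0, class2 C 0))
    & derivable_from_lagrangian C gamma <->
      exists k, multiplier C gamma k /\
                multiplier_classes C gamma k (0, class2 C 0)].
Proof.
have C_anti := structure_constants_anti hbr hE hC.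
have C_jacobi := structure_constants_jacobi hbr hE hC.
have classesP k := EP_lagrangian_classesP C_anti C_jacobi hgamma (k := k).
split=> //.
- move=> k mk; have [l sl hl] := multiplier_hessian mk.
  have hkE : hessian l = k by apply/funext.
  have [|mu [nu [mu_anti Dl]]] := EP_defect_affine C_anti hgamma sl.
    by rewrite hkE => w; exact: multiplier_lambda.
  split.
    exists (nu, class2 C mu); split; first by exists l, mu, nu.
    by move=> c; apply: multiplier_classes_unique; exists l, mu, nu.
  (* The cocycle property is checked on whichever [l'] and constants represent the pair, not only on
     those constructed above. *)
  move=> _ [l' [mu' [nu' [sl' hl' mu'_anti Dl' ->]]]] /=.
  have [cnu cmu] := multiplier_cocycles C_anti C_jacobi hgamma mk sl' hl'
    mu'_anti Dl'.
  by split=> //; exists mu'.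
- split=> [[l EPl]|[k [mk /(classesP k mk)[l [EPl _]]]]]; last by exists l.
  exists (hessian l).
  by have := EP_lagrangian_multiplier C_anti C_jacobi hgamma EPl.
Qed.
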